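(* Let $m\ge 2$ be even, $n\ge 1$, and for $\alpha\in\mathbb{R}$ let $\mathcal A_\alpha$ be the set of all $\beta=(\beta_1,\dots,\beta_{m-1})\in\mathbb{R}^{m-1}$ such that the radial solution $u_{\alpha,\beta}$ of $(-\Delta)^m u=e^u$ with initial data $(\alpha,\beta)$ is global. Then the following statements hold true: (i) if $n=1$ or $n=2$, then for any $\alpha\in\mathbb{R}$ the set $\mathcal A_\alpha$ is empty; (ii) if $n\ge 3$, then for any $\alpha\in\mathbb{R}$ the set $\mathcal A_\alpha$ is nonempty and moreover there exists a function $\Phi_\alpha:\mathbb{R}^{m-2}\to(-\infty,0)$ such that $$\mathcal A_\alpha=\{\beta=(\beta_1,\dots,\beta_{m-1})\in\mathbb{R}^{m-1}:\beta_{m-1}\le\Phi_\alpha(\beta_1,\dots,\beta_{m-2})\};$$ (iii) if $n\ge 3$, then for any $\alpha\in\mathbb{R}$, $\Phi_\alpha$ is a continuous function, $\mathcal A_\alpha$ is closed, the boundary $\partial\mathcal A_\alpha$ coincides with the graph of $\Phi_\alpha$, and the interior of $\mathcal A_\alpha$ is $$\{\beta=(\beta_1,\dots,\beta_{m-1})\in\mathbb{R}^{m-1}:\beta_{m-1}<\Phi_\alpha(\beta_1,\dots,\beta_{m-2})\};$$ (iv) if $n\ge 3$ and $m\ge 4$, then for any $\alpha\in\mathbb{R}$, $\Phi_\alpha$ is decreasing with respect to each variable, i.e. the map $t\mapsto\Phi_\alpha(\beta_1,\dots,\beta_{k-1},t,\beta_{k+1},\dots,\beta_{m-2})$ is decreasing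 in $\mathbb{R}$ for any $k\in\{1,\dots,m-2\}$ (and any values of the other variables).
   Context: A function $u=u(r)$ of $r\ge 0$ is identified with the radial function $x\mapsto u(|x|)$ on $\mathbb{R}^n$ (for $n=1$: an even function), and $\Delta u(r)=u''(r)+\frac{n-1}{r}u'(r)$ for $r>0$. Solutions are classical ($C^{2m}$, including at the origin). For $\alpha\in\mathbb{R}$ and $\beta=(\beta_1,\dots,\beta_{m-1})\in\mathbb{R}^{m-1}$, $u_{\alpha,\beta}$ denotes the unique local solution, on its maximal interval of continuation $[0,R_{\alpha,\beta})$ with $0<R_{\alpha,\beta}\le+\infty$, of $$(-\Delta)^m u(r)=e^{u(r)},\quad u(0)=\alpha,\ u'(0)=0,\quad \Delta^k u(0)=\beta_k,\ (\Delta^k u)'(0)=0\ \text{ for } k\in\{1,\dots,m-1\}.$$ It is called global if $R_{\alpha,\beta}=+\infty$. When $m=2$, the function $\Phi_\alpha$ is defined on the zero-dimensional space $\mathbb{R}^0=\{0\}$ and $\mathcal A_\alpha=\{\beta\in\mathbb{R}:\beta\le\Phi_\alpha(0)\}$. *)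

(* Defs.v *)
From HB Require Import structures.
From mathcomp Require Import all_boot all_order all_algebra.
From mathcomp Require Import all_classical all_reals all_analysis.
Set Implicit Arguments.
Unset Strict Implicit.
Unset Printing Implicit Defensive.
Import Order.TTheory GRing.Theory Num.Theory.
Import numFieldNormedType.Exports.
Local Open Scope classical_set_scope.
Local Open Scope ring_scope.

(* A radial function x |-> u(|x|) is represented by its profile, extended to an
   even function u : R -> R.  Only the values of u on ]-T, T[ matter for a
   function of r in [0, T[. *)

(* v''(r) + (n-1) v'(r)/r for r <> 0.  At r = 0 the quotient is replaced by its
   limit v''(0), as v'(0) = 0 for an even function, which gives n v''(0), the
   Laplacian of x |-> v(|x|) at the origin. *)
Definition laplacian (R : realType) (n : nat) (v : R -> R) (r : R) : R :=
  derive1n 2 v r +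
  n.-1%:R * (if r == 0 then derive1n 2 v 0 else derive1 v r / r).

(* u is of class C^k on ]-T, T[.  For an even u this is the C^k regularity,
   including at the origin, of the radial function x |-> u(|x|). *)
Definition is_Ck (R : realType) (k : nat) (T : \bar R) (u : R -> R) : Prop :=
  forall r : R, (`|r|%:E < T)%E ->
    (forall j, (j < k)%N -> derivable (derive1n j u) r 1) /\
    (forall j, (j <= k)%N -> {for r, continuous (derive1n j u)}).

(* For m >= 2 the number m.-2.+1 is m - 1, and the entry beta 0 k, for
   k : 'I_(m.-2.+1), is the datum beta_(k+1). *)
Definition radial_solution (R : realType) (m n : nat) (alpha : R)
    (beta : 'rV[R]_(m.-2.+1)) (u : R -> R) (T : \bar R) : Prop :=
  [/\ (0 < T)%E,
      (forall r, u (- r) = u r) /\ is_Ck (2 * m) T u,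
      forall r, 0 <= r -> (r%:E < T)%E ->
        iter m (fun v s => - laplacian n v s) u r = expR (u r),
      u 0 = alpha /\ derive1 u 0 = 0 &
      forall k : 'I_(m.-2.+1),
        iter k.+1 (laplacian n) u 0 = beta 0 k /\
        derive1 (iter k.+1 (laplacian n) u) 0 = 0].
Arguments radial_solution {R} m n alpha beta u T.

(* [0, T[ is the maximal interval of continuation of the solution u. *)
Definition maximal_solution (R : realType) (m n : nat) (alpha : R)
    (beta : 'rV[R]_(m.-2.+1)) (u : R -> R) (T : \bar R) : Prop :=
  radial_solution m n alpha beta u T /\
  forall (v : R -> R) (T' : \bar R), (T <= T')%E ->
    radial_solution m n alpha beta v T' ->
    (forall r, 0 <= r -> (r%:E < T)%E -> v r = u r) -> T' = T.
Arguments maximal_solution {R} m n alpha beta u T.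

(* The solution with given data being unique, "exists u" amounts to a statement
   about the solution u_(alpha, beta). *)
Definition global_data (R : realType) (m n : nat) (alpha : R) :
    set 'rV[R]_(m.-2.+1) :=
  [set beta | exists u : R -> R, maximal_solution m n alpha beta u +oo%E].
Arguments global_data {R} m n alpha.

(* (beta_1, ..., beta_(m-1)) |-> beta_(m-1) *)
Definition last_entry (R : realType) (p : nat) (beta : 'rV[R]_p.+1) : R :=
  beta 0 ord_max.

(* (beta_1, ..., beta_(m-1)) |-> (beta_1, ..., beta_(m-2)) *)
Definition init_entries (R : realType) (p : nat) (beta : 'rV[R]_p.+1) :
    'rV[R]_p := col' ord_max beta.

Definition set_entry (R : realType) (p : nat) (b : 'rV[R]_p) (k : 'I_p)
    (t : R) : 'rV[R]_p := \row_j (if j == k then t else b 0 j).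

Definition boundary (T : topologicalType) (A : set T) : set T :=
  closure A `\` interior A.

(* Main.v *)
Require Import Defs.
From HB Require Import structures.
From mathcomp Require Import all_boot all_order all_algebra.
From mathcomp Require Import all_classical all_reals all_analysis.
From mathcomp Require Import ring lra.
Import Order.TTheory GRing.Theory Num.Theory.
Import numFieldNormedType.Exports.
Local Open Scope classical_set_scope.
Local Open Scope ring_scope.
Set Implicit Arguments.
Unset Strict Implicit.
Unset Printing Implicit Defensive.

(** The equation is (-Delta)^m u = e^u with m even, that is Delta^m u = e^u.
    Write d = n - 1 and let K f, which is [invlap d f], be the radial function v
    with Delta v = f and v(0) = v'(0) = 0.  K is linear and monotone, and a
    global solution with
    data e_0 = alpha, e_1 = beta_1, ..., e_(m-1) = beta_(m-1) is the same
    thing as an even continuous u on R with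

      u = P_e + K^m (e^u),   P_e = sum over k < m of e_k q_k,

    where q_k = K^k 1 = c_k r^(2k) with c_k > 0 ([global_dataP]).  The
    right-hand side is [polysol d m e] applied to e^u, and all that follows is
    about this fixed point equation.

    Sub- and supersolutions.  By monotone iteration from below, an even
    continuous U with P_e + K^m (e^U) <= U suffices for a solution
    ([entire_data_of_supersolutions], which also allows e to be an increasing
    limit of data).  This makes the set of data of global solutions easy to
    study.  A solution for e is a supersolution for all smaller data, hence the
    set is downward closed ([entire_data_le]).  As exp is convex, a convex
    combination of solutions is a supersolution, hence the set is convex
    ([entire_data_convex]).

    Blow-up.  If Delta^(m-1) u is positive somewhere, it stays bounded below by
    a positive constant, so that all Delta^k u and their derivatives become
    positive.  From then on u(r + h) >= u(r) + c h^(2m) e^(u(r)) for h in [0, 1],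
    and u is infinite after a finite time.  So Delta^(m-1) u <= 0 for a global
    solution ([entire_level_le0]).  This bounds beta_(m-1) by 0, and bounds
    u by P_e with e_(m-1) replaced by 0.  With this barrier limits of
    solutions exist, and the last datum can be increased up to its supremum
    ([entire_data_closed]).  In dimension 1 or 2, Delta^(m-1) u is unbounded
    above since r^(n-1) (Delta^(m-1) u)' is increasing and 1/r is not
    integrable at infinity: there are no global solutions
    ([entire_low_dim]).

    Existence.  In dimension at least 3 the function 1 - (1 + r^2)^(-1/2) is
    bounded and its Laplacian is at least 3 (1 + r^2)^(-3).  When beta_(m-1) is
    very negative, a multiple of it absorbs e^U with U = O(1) - a r^2
    ([entire_data_nonempty]).

    The threshold Phi is the largest admissible beta_(m-1).  It is concave and
    nonincreasing in each variable, and a function with both properties is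
    continuous ([threshold_near]).  For the strict monotonicity in beta_k, the
    mean of the solutions u, v for two data that differ only by beta_k is a
    supersolution with room to spare: K^m of the convexity defect of exp grows
    at least like r^(2m-2), which permits to raise beta_(m-1) after lowering
    beta_k by any positive amount ([entire_data_strict]). *)

(** * Calculus on the real line *)

Section Calculus.
Context {R : realType}.
Implicit Types (f g h : R -> R) (a b c x y : R) (n k : nat).

Lemma is_derive_add f g x a b : is_derive x (1:R) f a -> is_derive x (1:R) g b ->
  is_derive x (1:R) (fun t => f t + g t) (a + b).
Proof. by move=> fa gb; exact: is_deriveD. Qed.

Lemma is_derive_sub f g x a b : is_derive x (1:R) f a -> is_derive x (1:R) g b ->
  is_derive x (1:R) (fun t => f t - g t) (a - b).
Proof. by move=> fa gb; exact: is_deriveB. Qed.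

Lemma is_derive_mul f g x a b : is_derive x (1:R) f a -> is_derive x (1:R) g b ->
  is_derive x (1:R) (fun t => f t * g t) (a * g x + f x * b).
Proof.
move=> fa gb; apply: is_derive_eq (is_deriveM fa gb) _.
by rewrite /GRing.scale/= addrC mulrC; congr (_ + _); rewrite mulrC.
Qed.

Lemma is_derive_const c x : is_derive x (1:R) (fun=> c) 0.
Proof. exact: is_derive_cst. Qed.

Lemma is_derive_pow n x : is_derive x (1:R) (fun t => t ^+ n) (n%:R * x ^+ n.-1).
Proof.
split; first exact: exprn_derivable.
by rewrite exp_derive /GRing.scale/= mulr1.
Qed.

Lemma is_derive_inv f x a : f x != 0 -> is_derive x (1:R) f a ->
  is_derive x (1:R) (fun t => (f t)^-1) (- (a / f x ^+ 2)).
Proof.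
move=> f0 fa; apply: is_derive_eq (is_deriveV f0 fa) _.
by rewrite /GRing.scale/= mulNr mulrC.
Qed.

Lemma is_derive_scale c f x a : is_derive x (1:R) f a ->
  is_derive x (1:R) (fun t => c * f t) (c * a).
Proof. by move=> fa; exact: is_deriveZ. Qed.

Lemma is_derive_opp f x a : is_derive x (1:R) f a ->
  is_derive x (1:R) (fun t => - f t) (- a).
Proof. by move=> fa; exact: is_deriveN. Qed.

Lemma is_derive_reflect f x a : is_derive (- x) (1:R) f a ->
  is_derive x (1:R) (fun t => f (- t)) (- a).
Proof.
move=> fa; have h : is_derive x (1:R) (-%R : R -> R) (-1) by exact: is_deriveNid.
by have := is_derive1_comp fa h; rewrite mulrN1.
Qed.

Lemma derive1_val f x a : is_derive x (1:R) f a -> derive1 f x = a.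
Proof. by move=> fa; rewrite derive1E; exact: derive_val. Qed.

Lemma derivable_is_derive f x : derivable f x 1 -> is_derive x (1:R) f (derive1 f x).
Proof. by rewrite derive1E; exact: derivableP. Qed.

Lemma is_derive_derivable f x a : is_derive x (1:R) f a -> derivable f x 1.
Proof. by case. Qed.

Lemma is_derive_continuous f x a : is_derive x (1:R) f a -> {for x, continuous f}.
Proof.
by case=> fx _; exact/differentiable_continuous/derivable1_diffP.
Qed.

Lemma continuous_subspace_cc f a b : (forall x, a <= x <= b -> {for x, continuous f}) ->
  {within `[a, b], continuous f}.
Proof.
move=> cf; apply: continuous_in_subspaceT => x.
by rewrite inE /= in_itv/= => /cf.
Qed.

Lemma nondecreasing_of_derive f g a b :
  (forall x, a <= x <= b -> {for x, continuous f}) ->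
  (forall x, a < x < b -> is_derive x (1:R) f (g x)) ->
  (forall x, a < x < b -> 0 <= g x) ->
  a <= b -> f a <= f b.
Proof.
move=> cf df g0 ab; apply: (@ger0_derive1_ndecr _ f a b) => //.
- by move=> x; rewrite in_itv/= => /df [].
- by move=> x; rewrite in_itv/= => xab; rewrite (derive1_val (df _ xab)) g0.
- exact: continuous_subspace_cc.
Qed.

Lemma constant_of_derive0 f a b :
  (forall x, a <= x <= b -> {for x, continuous f}) ->
  (forall x, a < x < b -> is_derive x (1:R) f 0) ->
  a <= b -> f a = f b.
Proof.
move=> cf df ab; apply/eqP; rewrite eq_le; apply/andP; split.
  by apply: (@nondecreasing_of_derive _ (fun=> 0)).
rewrite -lerN2; apply: (@nondecreasing_of_derive (fun x => - f x) (fun=> 0)) => // x xab.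
  by apply: continuousN; exact: cf.
by rewrite -oppr0; apply: is_derive_opp; exact: df.
Qed.

Lemma primitive_near f N : continuous f -> 
  exists F : R -> R, forall x, - N < x < N -> is_derive x (1:R) F (f x).
Proof.
move=> cf; pose mu := @lebesgue_measure R.
exists (fun x => \int[mu]_(t in [set` `[- N, x]]) f t)%R => x /andP[Nx xN].
have [] := @continuous_FTC1_closed R f (- N) x N xN _ Nx (cf x).
  apply: continuous_compact_integrable; first exact: segment_compact.
  by apply: continuous_subspaceT.
by move=> dF <-; exact: derivable_is_derive.
Qed.

(** Integrals based at -N give primitives on ]-N, N[.  Normalised at 0 they
    agree on common domains, so they glue to a primitive on R. *)
Lemma primitive_ex f : continuous f ->
  exists F : R -> R, F 0 = 0 /\ forall x, is_derive x (1:R) F (f x).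
Proof.
move=> cf.
have [G HG] := @boolp.choice R (R -> R)
  (fun N F => forall x, - N < x < N -> is_derive x (1:R) F (f x))
  (fun N => @primitive_near f N cf).
exists (fun x => G (`|x| + 1) x - G (`|x| + 1) 0); split.
  by rewrite normr0 subrr.
move=> x; pose N := `|x| + 2.
have xN : - N < x < N by rewrite /N; have := ler_norm x; have := ler_norm (- x);
  rewrite normrN; lra.
have h : is_derive x (1:R) (fun t => G N t - G N 0) (f x).
  by rewrite -[f x]subr0; exact: is_derive_sub (HG N x xN) (is_derive_const _ _).
apply: near_eq_is_derive h; near=> y.
have yx : `|x - y| < 1 by near: y; apply: cvgr_dist_lt (ltr01) => //; exact: cvg_id.
have yN : `|y| + 1 <= N.
  rewrite /N. have : `|y| <= `|x| + `|x - y|.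
    by rewrite -{1}(subKr x y) ler_normB.
  lra.
set M := `|y| + 1.
have My : - M < y < M by rewrite /M; have := ler_norm y; have := ler_norm (- y);
  rewrite normrN; lra.
have M0 : 0 < M by rewrite /M ltr_wpDl.
pose D t := G N t - G M t.
have dD t : - M < t < M -> is_derive t (1:R) D 0.
  move=> tM; rewrite -(subrr (f t)); apply: is_derive_sub; apply: HG => //.
  by move: tM yN; rewrite -/M; lra.
suff : D y = D 0 by rewrite /D -/N -/M; lra.
have [y0|/ltW y0] := leP 0 y; [apply/esym|]; apply: (@constant_of_derive0 D) => // t ty;
  by [apply: is_derive_continuous (@dD t _); lra | apply: dD; lra].
Unshelve. all: by end_near. Qed.

(** A total function of f, so that no integrability condition appears when the
    operators below are composed. *)
Definition primitive f : R -> R :=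
  xget (fun=> 0) [set F : R -> R | F 0 = 0 /\ forall x, is_derive x (1:R) F (f x)].

Lemma primitiveP f : continuous f ->
  primitive f 0 = 0 /\ forall x, is_derive x (1:R) (primitive f) (f x).
Proof.
by move=> /primitive_ex[F FP]; rewrite /primitive; exact: (@xgetPex _ _ [set F : R ->
  R | _]) (ex_intro _ F FP).
Qed.

Lemma primitive0 f : continuous f -> primitive f 0 = 0.
Proof. by case/primitiveP. Qed.

Lemma is_derive_primitive f : continuous f -> forall x, is_derive x (1:R) (primitive f) (f x).
Proof. by case/primitiveP. Qed.

(** The functions met below are quotients by powers of the variable, whose
    derivative is computed off 0 only. *)
Lemma primitive_of_derive_off0 g h : continuous g -> continuous h ->
  (forall x, x != 0 -> is_derive x (1:R) g (h x)) ->
  forall x, g x = g 0 + primitive h x.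
Proof.
move=> cg ch dg x; pose D t := g t - primitive h t.
have cD : continuous D.
  by move=> t; apply: continuousB; [exact: cg|exact: is_derive_continuous
    (is_derive_primitive ch t)].
suff : D x = D 0 by rewrite /D primitive0//; lra.
have dD t : t != 0 -> is_derive t (1:R) D 0.
  by move=> t0; rewrite -(subrr (h t)); apply: is_derive_sub;
    [exact: dg|exact: is_derive_primitive].
have [x0|/ltW x0] := leP 0 x.
  by apply/esym; apply: (@constant_of_derive0 D) x0 => [t _|t /andP[t1 t2]];
    [exact: cD|apply: dD; rewrite gt_eqF].
by apply: (@constant_of_derive0 D) x0 => [t _|t /andP[t1 t2]]; [exact: cD|apply: dD;
  rewrite lt_eqF].
Qed.

(** A singularity of the derivative at 0 is removable as soon as it has a
    continuous extension h, since g - g(0) is then the primitive of h. *)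
Lemma is_derive_extend0 g h : continuous g -> continuous h ->
  (forall x, x != 0 -> is_derive x (1:R) g (h x)) ->
  forall x, is_derive x (1:R) g (h x).
Proof.
move=> cg ch dg x.
have -> : g = fun t => g 0 + primitive h t by apply/funext => t;
  exact: primitive_of_derive_off0.
by rewrite -[h x]add0r; exact: is_derive_add (is_derive_const _ _) (is_derive_primitive ch x).
Qed.

End Calculus.

(** * Weighted means over [0, s] *)

Section Means.
Context {R : realType}.
Implicit Types (f g h : R -> R) (a b c x y s t : R) (d k : nat).

Lemma primitive_unique f G : continuous f -> G 0 = 0 ->
  (forall x, is_derive x (1:R) G (f x)) -> primitive f = G.
Proof.
move=> cf G0 dG; apply/funext => x.
rewrite (@primitive_of_derive_off0 _ G f) ?G0 ?add0r//.
by move=> t; exact: is_derive_continuous (dG t).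
Qed.

Lemma cont_mul f g : continuous f -> continuous g -> continuous (fun t => f t * g t).
Proof. by move=> cf cg t; apply: continuousM; [exact: cf|exact: cg]. Qed.

Lemma cont_add f g : continuous f -> continuous g -> continuous (fun t => f t + g t).
Proof. by move=> cf cg t; apply: continuousD; [exact: cf|exact: cg]. Qed.

Lemma cont_sub f g : continuous f -> continuous g -> continuous (fun t => f t - g t).
Proof. by move=> cf cg t; apply: continuousB; [exact: cf|exact: cg]. Qed.

Lemma cont_const c : continuous (fun _ : R => c).
Proof. by move=> t; exact: cvg_cst. Qed.

Lemma cont_scale c f : continuous f -> continuous (fun t => c * f t).
Proof. by move=> cf; apply: cont_mul => //; exact: cont_const. Qed.

Lemma cont_pow k : continuous (fun t : R => t ^+ k).
Proof. by move=> t; exact: exprn_continuous. Qed.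

Lemma cont_reflect f : continuous f -> continuous (fun t => f (- t)).
Proof.
by move=> cf t; apply: (@continuous_comp _ _ _ -%R f); [exact: opp_continuous|exact: cf].
Qed.

Definition moment d f : R -> R := primitive (fun t => t ^+ d * f t).

(** This is the integral over [0, 1] of tau^d f(s tau).  For d = n - 1 it is
    the mean of f over the ball of radius s in R^n, divided by n. *)
Definition mean d f s :=
  if s == 0 then f 0 / d.+1%:R else moment d f s / s ^+ d.+1.

Lemma moment_integrand_cont d f : continuous f -> continuous (fun t => t ^+ d * f t).
Proof. by move=> cf; apply: cont_mul => //; exact: cont_pow. Qed.

Lemma moment0 d f : continuous f -> moment d f 0 = 0.
Proof. by move=> cf; rewrite /moment primitive0//; exact: moment_integrand_cont. Qed.

Lemma is_derive_moment d f x : continuous f -> is_derive x (1:R) (moment d f) (x ^+ d * f x).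
Proof. by move=> cf; have := is_derive_primitive (moment_integrand_cont (d:=d) cf) x. Qed.

Lemma meanE d f s : s != 0 -> mean d f s = moment d f s / s ^+ d.+1.
Proof. by rewrite /mean => /negbTE ->. Qed.

Lemma mean_at0 d f : mean d f 0 = f 0 / d.+1%:R.
Proof. by rewrite /mean eqxx. Qed.

Lemma is_derive_mean_neq0 d f x : continuous f -> x != 0 ->
  is_derive x (1:R) (mean d f) ((f x - d.+1%:R * mean d f x) / x).
Proof.
move=> cf x0.
have xd : x ^+ d.+1 != 0 by rewrite expf_neq0.
have h := is_derive_mul (is_derive_moment d (x) cf) (is_derive_inv (f :=
  fun t : R => t ^+ d.+1) xd (is_derive_pow d.+1 x)).
apply: near_eq_is_derive; last first.
  apply: is_derive_eq h _; rewrite meanE//= !exprS; field.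
  by rewrite x0 expf_neq0.
near=> y; rewrite meanE//; near: y.
by apply: (@open_neq _ 0 x).
Unshelve. all: by end_near. Qed.

Lemma moment_lin d a b f g : continuous f -> continuous g ->
  moment d (fun t => a * f t + b * g t) = fun s => a * moment d f s + b * moment d g s.
Proof.
move=> cf cg; apply: primitive_unique.
- by apply: moment_integrand_cont; apply: cont_add; exact: cont_scale.
- by rewrite !moment0// !mulr0 addr0.
- move=> x; apply: is_derive_eq (is_derive_add (is_derive_scale a (is_derive_moment d (x)
  cf)) (is_derive_scale b (is_derive_moment d (x) cg))) _.
  by ring.
Qed.

Lemma mean_lin d a b f g : continuous f -> continuous g ->
  mean d (fun t => a * f t + b * g t) = fun s => a * mean d f s + b * mean d g s.
Proof.
move=> cf cg; apply/funext => s; rewrite /mean moment_lin//.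
by case: eqP => _; ring.
Qed.

Lemma mean_cst d c s : mean d (fun=> c) s = c / d.+1%:R.
Proof.
rewrite /mean; case: eqP => // /eqP s0.
have -> : moment d (fun=> c) = fun t => c / d.+1%:R * t ^+ d.+1.
  apply: primitive_unique; first by apply: moment_integrand_cont; exact: cont_const.
    by rewrite expr0n/= mulr0.
  move=> x; apply: is_derive_eq (is_derive_scale _ (is_derive_pow d.+1 x)) _ => /=.
  by rewrite mulrA divfK ?pnatr_eq0// mulrC.
by rewrite mulfK// expf_neq0.
Qed.

Lemma mean_reflect d f s : continuous f -> mean d (fun t => f (- t)) s = mean d f (- s).
Proof.
move=> cf; rewrite /mean oppr_eq0 oppr0; case: eqP => // /eqP s0.
have -> : moment d (fun t => f (- t)) = fun t => (-1) ^+ d.+1 * moment d f (- t).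
  apply: primitive_unique; first by apply: moment_integrand_cont; exact: cont_reflect.
    by rewrite oppr0 moment0// mulr0.
  move=> x; apply: is_derive_eq (is_derive_scale _ (is_derive_reflect (is_derive_moment d
    (-x) cf))) _.
  by rewrite (exprNn x) exprS mulN1r mulNr mulrN opprK !mulrA -exprMn mulN1r opprK expr1n
    mul1r.
rewrite (exprNn s) invfM mulrA [_ * moment _ _ _]mulrC; congr (_ * _ * _).
by rewrite -signr_odd; case: odd; rewrite ?expr0 ?expr1 ?invr1 ?invrN1.
Qed.

(** The values of f and g on [0, s] only are compared, which is what uniform
    convergence on compact sets needs. *)
Lemma mean_le d f g s : continuous f -> continuous g -> 0 <= s ->
  (forall t, 0 <= t <= s -> f t <= g t) -> mean d f s <= mean d g s.
Proof.
move=> cf cg s0 fg; rewrite /mean; case: eqP => [_|/eqP sn0].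
  by rewrite ler_wpM2r// fg// lexx.
rewrite ler_wpM2r ?invr_ge0 ?exprn_ge0//.
suff : moment d g 0 - moment d f 0 <= moment d g s - moment d f s.
  by rewrite !moment0// subrr subr_ge0.
have dD t : is_derive t (1:R) (fun t => moment d g t - moment d f t) (t ^+ d * g t - t ^+
  d * f t).
  exact: is_derive_sub (is_derive_moment d t cg) (is_derive_moment d t cf).
apply: (nondecreasing_of_derive (f := fun t => moment d g t - moment d f t)) s0 => [t _|t].
- exact: is_derive_continuous (dD t).
- move=> /andP[t0 ts]; rewrite -mulrBr; apply: mulr_ge0; first exact/exprn_ge0/ltW.
  by rewrite subr_ge0 fg// !ltW.
Qed.

Lemma mean_dist d f s e : continuous f -> 0 <= s ->
  (forall t, 0 <= t <= s -> `|f 0 - f t| <= e) -> `|mean d f 0 - mean d f s| <= e.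
Proof.
move=> cf s0 fe.
have e0 : 0 <= e by apply: le_trans (fe 0 _); rewrite ?lexx.
have d1 : (d.+1%:R : R)^-1 <= 1 by rewrite invf_le1 ?ltr0n// ler1n.
have d0 : 0 <= (d.+1%:R : R)^-1 by rewrite invr_ge0.
have ed : e / d.+1%:R <= e by rewrite ler_piMr.
have h1 : mean d f s <= (f 0 + e) / d.+1%:R.
  rewrite -(mean_cst d (f 0 + e) s); apply: mean_le => // [|t /fe].
    exact: cont_const.
  by rewrite ler_norml; lra.
have h2 : (f 0 - e) / d.+1%:R <= mean d f s.
  rewrite -(mean_cst d (f 0 - e) s); apply: mean_le => // [|t /fe].
    exact: cont_const.
  by rewrite ler_norml; lra.
move: h1 h2; rewrite mulrDl mulrBl mean_at0 ler_norml.
set u := f 0 / _; set v := e / _ in ed *; set w := mean d f s; move: u v w ed => u v w; lra.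
Qed.

(** Off 0 the mean is a quotient of continuous functions.  At 0 it is squeezed
    between means of constants for s > 0, and s < 0 reduces to s > 0 by
    reflection of f. *)
Lemma mean_continuous d f : continuous f -> continuous (mean d f).
Proof.
move=> cf s; have [->|s0] := eqVneq s 0;
  last exact: is_derive_continuous (is_derive_mean_neq0 d cf s0).
apply/cvgrPdist_le => e e0.
have /cvgrPdist_le /(_ e e0) /nbhs_ballP[r/= r0 Hr] := cf 0.
near=> t.
have tr : `|t| < r.
  by rewrite -normrN -[- t]add0r; near: t; apply: cvgr_dist_lt r0 => //; exact: cvg_id.
have key g y : continuous g -> 0 <= y -> (forall t, 0 <= t <= y -> `|g 0 - g t| <= e) ->
  `|mean d g 0 - mean d g y| <= e.
  exact: mean_dist.
have [t0|/ltW t0] := leP 0 t.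
  apply: mean_dist => // u /andP[u0 ut]; apply: Hr; rewrite /ball/= sub0r normrN.
  by rewrite ger0_norm// (le_lt_trans ut)// (le_lt_trans _ tr)// ler_norm.
rewrite -[t]opprK -mean_reflect// -[X in `|X - _|](_ : mean d (fun t => f (- t)) 0 = _);
  last first.
  by rewrite mean_reflect// oppr0.
apply: mean_dist; [exact: cont_reflect|by rewrite oppr_ge0|].
move=> u /andP[u0 ut]; rewrite oppr0; apply: Hr; rewrite /ball/= sub0r opprK.
by rewrite ger0_norm// (le_lt_trans ut)// (le_lt_trans _ tr)// -normrN ler_norm.
Unshelve. all: by end_near. Qed.

(** The recursion starts from the derivative: this suits operators that commute
    with differentiation up to a change of weight. *)
Fixpoint Ck k f : Prop :=
  if k is k'.+1 then (forall x, derivable f x 1) /\ Ck k' (derive1 f)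
  else continuous f.

Lemma Ck_cont k f : Ck k f -> continuous f.
Proof.
by case: k => // k [df _] x; exact/differentiable_continuous/derivable1_diffP.
Qed.

Lemma Ck_leq k j f : (j <= k)%N -> Ck k f -> Ck j f.
Proof.
elim: k j f => [|k ih] [|j] f //; first by move=> _; exact: Ck_cont.
by move=> jk [df ckf]; split=> //; exact: ih ckf.
Qed.

Lemma CkS k f g : (forall x, is_derive x (1:R) f (g x)) -> Ck k g -> Ck k.+1 f.
Proof.
move=> df cg; split; first by move=> x; exact: is_derive_derivable (df x).
by rewrite (_ : derive1 f = g)//; apply/funext => x; exact: derive1_val.
Qed.

Lemma CkS_dv k f x : Ck k.+1 f -> is_derive x (1:R) f (derive1 f x).
Proof. by case=> df _; exact: derivable_is_derive. Qed.

Lemma Ck_lin k a b f g : Ck k f -> Ck k g -> Ck k (fun t => a * f t + b * g t).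
Proof.
elim: k f g => [|k ih] f g; first by move=> cf cg; apply: cont_add; exact: cont_scale.
move=> Cf Cg; apply: (@CkS _ _ (fun t => a * derive1 f t + b * derive1 g t)).
  by move=> x; exact: is_derive_add (is_derive_scale a (CkS_dv x Cf)) (is_derive_scale b
    (CkS_dv x Cg)).
by apply: ih; [case: Cf|case: Cg].
Qed.

Lemma Ck_cst k c : Ck k (fun=> c).
Proof.
elim: k c => [|k ih] c; first exact: cont_const.
by apply: (@CkS _ _ (fun=> 0)) => // x; exact: is_derive_const.
Qed.

(** Differentiation under the integral sign in the integral over [0, 1] of
    tau^d f(s tau) raises the weight to tau^(d+1).  Off 0 the formula amounts
    to an integration by parts, and its right-hand side is continuous at 0. *)
Lemma is_derive_mean d f : Ck 1 f ->
  forall x, is_derive x (1:R) (mean d f) (mean d.+1 (derive1 f) x).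
Proof.
move=> Cf; have cf := Ck_cont Cf; have cf' : continuous (derive1 f) by case: Cf.
apply: is_derive_extend0; [exact: mean_continuous|exact: mean_continuous|].
move=> x x0; apply: is_derive_eq (is_derive_mean_neq0 d cf x0) _.
rewrite [RHS](meanE _ _ x0).
have -> : moment d.+1 (derive1 f) = fun t => t ^+ d.+1 * f t - d.+1%:R * moment d f t.
  apply: primitive_unique; first exact: moment_integrand_cont.
    by rewrite moment0// mulr0 expr0n/= mul0r subr0.
  move=> t; apply: is_derive_eq (is_derive_sub (is_derive_mul (is_derive_pow d.+1 t)
    (CkS_dv _ Cf)) (is_derive_scale _ (is_derive_moment d (t) cf))) _.
  by rewrite /=; ring.
rewrite meanE//= !exprS; field.
by rewrite x0 expf_neq0.
Qed.

Lemma mean_Ck k d f : Ck k f -> Ck k (mean d f).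
Proof.
elim: k d f => [|k ih] d f Cf; first exact: mean_continuous.
apply: (CkS (g := mean d.+1 (derive1 f))).
  by apply: is_derive_mean; apply: Ck_leq Cf.
by apply: ih; case: Cf.
Qed.

End Means.

(** * The inverse of the radial Laplacian *)

Section RadialInverse.
Context {R : realType}.
Implicit Types (f g h v : R -> R) (a b c x y s t : R) (d k : nat).

(** The profiles of continuous radial functions. *)
Definition even_cont f := (forall t, f (- t) = f t) /\ continuous f.

Lemma even_cont_lin a b f g : even_cont f -> even_cont g ->
  even_cont (fun t => a * f t + b * g t).
Proof.
move=> [ef cf] [eg cg]; split; first by move=> t; rewrite ef eg.
by apply: cont_add; exact: cont_scale.
Qed.

Lemma even_cont_const c : even_cont (fun=> c).
Proof. by split=> //; exact: cont_const. Qed.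

Lemma even_contD f g : even_cont f -> even_cont g -> even_cont (fun t => f t + g t).
Proof. by move=> [ef cf] [eg cg]; split; [move=> t; rewrite ef eg|exact: cont_add]. Qed.

Lemma even_contM f g : even_cont f -> even_cont g -> even_cont (fun t => f t * g t).
Proof. by move=> [ef cf] [eg cg]; split; [move=> t; rewrite ef eg|exact: cont_mul]. Qed.

Lemma even_contZ c f : even_cont f -> even_cont (fun t => c * f t).
Proof. by apply: even_contM; exact: even_cont_const. Qed.

Lemma even_cont_exp f : even_cont f -> even_cont (fun t => expR (f t)).
Proof.
move=> [ef cf]; split; first by move=> t; rewrite ef.
by move=> t; apply: (@continuous_comp _ _ _ f expR); [exact: cf|exact: continuous_expR].
Qed.

Lemma even_cont_norm f t : even_cont f -> f `|t| = f t.
Proof. by move=> [ef _]; case: ger0P => // _; rewrite ef. Qed.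

Lemma mean_even_cont d f : even_cont f -> even_cont (mean d f).
Proof.
move=> [ef cf]; split; last exact: mean_continuous.
by move=> t; rewrite -mean_reflect//; congr (mean d _ _); apply/funext => s.
Qed.

(** In dimension d + 1 the equation Delta v = f reads (s^d v')' = s^d f, so
    v' = s * mean d f s when v'(0) = 0. *)
Definition invlap d f : R -> R := primitive (fun s => s * mean d f s).

Lemma idmean_cont d f : continuous f -> continuous (fun s => s * mean d f s).
Proof. by move=> cf; apply: cont_mul; [move=> t; exact: cvg_id|exact: mean_continuous]. Qed.

Lemma invlap0 d f : continuous f -> invlap d f 0 = 0.
Proof. by move=> cf; apply: primitive0; exact: idmean_cont. Qed.

Lemma is_derive_invlap d f x : continuous f -> is_derive x (1:R) (invlap d f) (x * mean d f x).
Proof. by move=> cf; have := is_derive_primitive (idmean_cont (d:=d) cf) x. Qed.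

(** With (invlap d f)' = s * mean d f s this gives the second derivative also
    at the origin, where f(0) - d f(0)/(d+1) = f(0)/(d+1). *)
Lemma is_derive_idmean d f x : continuous f ->
  is_derive x (1:R) (fun s => s * mean d f s) (f x - d%:R * mean d f x).
Proof.
move=> cf; have cm := mean_continuous (d:=d) cf; move: x; apply: is_derive_extend0.
- exact: idmean_cont.
- by apply: cont_sub => //; exact: cont_scale.
- move=> x x0; apply: is_derive_eq (is_derive_mul (is_derive_id x (1:R))
  (is_derive_mean_neq0 d cf x0)) _.
  by rewrite -natr1 mulrC /=; field.
Qed.

Lemma invlap_lin d a b f g : continuous f -> continuous g ->
  invlap d (fun t => a * f t + b * g t) = fun s => a * invlap d f s + b * invlap d g s.
Proof.
move=> cf cg; apply: primitive_unique.
- by apply: idmean_cont; apply: cont_add; exact: cont_scale.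
- by rewrite !invlap0// !mulr0 addr0.
- move=> x; apply: is_derive_eq (is_derive_add (is_derive_scale a (is_derive_invlap d x
  cf)) (is_derive_scale b (is_derive_invlap d x cg))) _.
  by rewrite mean_lin//; ring.
Qed.

Lemma invlap_even_cont d f : even_cont f -> even_cont (invlap d f).
Proof.
move=> ecf; have [em cm] := mean_even_cont d ecf; have [_ cf] := ecf; split; last first.
  by move=> x; exact: is_derive_continuous (is_derive_invlap d x cf).
suff h : invlap d f = fun t => invlap d f (- t) by move=> t; rewrite [in RHS]h.
apply: primitive_unique; [exact: idmean_cont|by rewrite oppr0 invlap0|].
move=> x; apply: is_derive_eq (is_derive_reflect (is_derive_invlap d (- x) cf)) _.
by rewrite em; ring.
Qed.

Lemma invlap_Ck k d f : Ck k f -> Ck k.+2 (invlap d f).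
Proof.
move=> Cf; have cf := Ck_cont Cf.
apply: (CkS (g := fun s => s * mean d f s)); first by move=> x; exact: is_derive_invlap.
apply: (CkS (g := fun s => 1 * f s + (- d%:R) * mean d f s)).
  by move=> x; apply: is_derive_eq (is_derive_idmean d x cf) _; rewrite mul1r mulNr.
by apply: Ck_lin => //; exact: mean_Ck.
Qed.

(** Monotonicity of K for increments, not only for values: it yields both the
    monotonicity of K and the equicontinuity of the family of the K f with
    0 <= f <= g. *)
Lemma invlap_increment_le d f g r s : continuous f -> continuous g -> 0 <= r -> r <= s ->
  (forall t, 0 <= t <= s -> f t <= g t) ->
  invlap d f s - invlap d f r <= invlap d g s - invlap d g r.
Proof.
move=> cf cg r0 rs fg.
suff : invlap d g r - invlap d f r <= invlap d g s - invlap d f s by lra.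
have dD t : is_derive t (1:R) (fun t => invlap d g t - invlap d f t) (t * mean d g t - t
  * mean d f t).
  exact: is_derive_sub (is_derive_invlap d t cg) (is_derive_invlap d t cf).
apply: (nondecreasing_of_derive (f := fun t => invlap d g t - invlap d f t)) rs => [t _|t].
  exact: is_derive_continuous (dD t).
move=> /andP[rt ts]; rewrite -mulrBr; apply: mulr_ge0.
  exact: le_trans r0 (ltW rt).
rewrite subr_ge0; apply: mean_le => //; first exact: le_trans r0 (ltW rt).
by move=> u /andP[u0 ut]; apply: fg; rewrite u0 (le_trans ut)// ltW.
Qed.

Lemma invlap_le_on d f g s : continuous f -> continuous g -> 0 <= s ->
  (forall t, 0 <= t <= s -> f t <= g t) -> invlap d f s <= invlap d g s.
Proof.
move=> cf cg s0 fg; have := @invlap_increment_le d f g 0 s cf cg (lexx _) s0 fg.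
by rewrite !invlap0// !subr0.
Qed.

Lemma invlap_le d f g : even_cont f -> even_cont g -> (forall t, f t <= g t) ->
  forall t, invlap d f t <= invlap d g t.
Proof.
move=> ef eg fg t; rewrite -(even_cont_norm t (invlap_even_cont d ef)) -(even_cont_norm t
  (invlap_even_cont d eg)).
by apply: invlap_le_on; [case: ef|case: eg| |].
Qed.

Lemma invlap_zero d : invlap d (fun=> 0) = fun=> 0.
Proof.
apply: primitive_unique => //; first exact/idmean_cont/cont_const.
by move=> x; rewrite mean_cst mul0r mulr0; exact: is_derive_const.
Qed.

Lemma invlap_nondecreasing d f r s : continuous f -> 0 <= r -> r <= s ->
  (forall t, 0 <= t <= s -> 0 <= f t) -> invlap d f r <= invlap d f s.
Proof.
move=> cf r0 rs f0; have := @invlap_increment_le d _ _ r s (@cont_const R 0) cf r0 rs f0.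
by rewrite invlap_zero; lra.
Qed.

Lemma derive1_invlap d c f : continuous f ->
  derive1 (fun t => c + invlap d f t) = fun s => s * mean d f s.
Proof.
move=> cf; apply/funext => x; apply: derive1_val.
by apply: is_derive_eq (is_derive_add (is_derive_const c x) (is_derive_invlap d x cf)) _;
  rewrite add0r.
Qed.

Lemma lap_invlap d c f : continuous f -> laplacian d.+1 (fun t => c + invlap d f t) = f.
Proof.
move=> cf; apply/funext => x; rewrite /laplacian /=.
rewrite [X in derive1 X x]derive1_invlap// [X in derive1 X 0]derive1_invlap//.
rewrite (derive1_val (is_derive_idmean d x cf)) (derive1_val (is_derive_idmean d 0 cf)).
case: eqP => [->|/eqP x0].
  by rewrite mean_at0 -natr1; field; rewrite natr1 pnatr_eq0.
by rewrite derive1_invlap// [x * _]mulrC mulfK// subrK.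
Qed.

Lemma derive1_even v : (forall t, v (- t) = v t) -> (forall x, derivable v x 1) ->
  forall t, derive1 v (- t) = - derive1 v t.
Proof.
move=> ev dv t; have h := is_derive_reflect (derivable_is_derive (dv (- t))).
have -> : v = fun t => v (- t) by apply/funext => s.
rewrite (derive1_val h) -[in LHS](_ : v = fun t => v (- t)) ?opprK//.
by apply/funext => s.
Qed.

Lemma derive1_odd v : (forall t, v (- t) = - v t) -> (forall x, derivable v x 1) ->
  forall t, derive1 v (- t) = derive1 v t.
Proof.
move=> ov dv t; have h := is_derive_opp (is_derive_reflect (derivable_is_derive (dv (- t)))).
have e : v = fun t => - v (- t) by apply/funext => s; rewrite ov opprK.
by rewrite [in RHS]e (derive1_val h) opprK.
Qed.

Section EvenC2.
Context (v : R -> R) (k : nat) (ev : forall t, v (- t) = v t) (Cv : Ck k.+2 v).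

Let v1 := derive1 v.
Let v2 := derive1 v1.

Lemma even_derive1_0 : v1 0 = 0.
Proof.
have [dv _] := Cv; have := derive1_even ev dv 0; rewrite oppr0 /v1.
by move: (derive1 v 0) => y; lra.
Qed.

Lemma even_derive2_even_cont : even_cont v2.
Proof.
have [dv [dv1 cv2]] := Cv; split; last exact: (Ck_cont cv2).
by apply: derive1_odd dv1 => t; exact: derive1_even.
Qed.

(** The quotient v'/r is the mean of v'' over [0, r].  Through it the Laplacian
    of an even function of class C^(k+2) is seen to be of class C^k at the
    origin. *)
Lemma derive1_mean t : v1 t = t * mean 0 v2 t.
Proof.
have [_ cv2] := even_derive2_even_cont.
have [->|t0] := eqVneq t 0; first by rewrite even_derive1_0 mul0r.
rewrite meanE// expr1 mulrC divfK//.
suff -> : moment 0 v2 = v1 by [].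
apply: primitive_unique; [exact: moment_integrand_cont|exact: even_derive1_0|].
move=> x; rewrite expr0 mul1r; have [_ C1] := Cv; exact: CkS_dv C1.
Qed.

Lemma lap_mean d : laplacian d.+1 v = fun t => 1 * v2 t + d%:R * mean 0 v2 t.
Proof.
apply/funext => t; rewrite /laplacian /= -/v1 -/v2 mul1r.
case: eqP => [->|/eqP t0]; first by rewrite mean_at0 divr1.
by rewrite derive1_mean [t * _]mulrC mulfK.
Qed.

Lemma lap_Ck d : Ck k (laplacian d.+1 v).
Proof.
have [_ [_ C2]] := Cv.
by rewrite lap_mean; apply: Ck_lin => //; exact: mean_Ck.
Qed.

Lemma lap_even_cont d : even_cont (laplacian d.+1 v).
Proof.
have e2 := even_derive2_even_cont.
by rewrite lap_mean; apply: even_cont_lin => //; exact: mean_even_cont.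
Qed.

(** Uniqueness for Delta v = f with given v(0) and v'(0) = 0: it turns
    differential equations into integral equations. *)
Lemma invlap_lap d : v = fun t => v 0 + invlap d (laplacian d.+1 v) t.
Proof.
have [el cl] := lap_even_cont d; have [_ cv2] := even_derive2_even_cont.
apply/funext; apply: primitive_of_derive_off0.
- exact: Ck_cont Cv.
- exact: idmean_cont.
move=> x x0; have -> : x * mean d (laplacian d.+1 v) x = v1 x; last exact: CkS_dv Cv.
rewrite meanE//.
have -> : moment d (laplacian d.+1 v) = fun t => t ^+ d * v1 t.
  apply: primitive_unique; first exact: moment_integrand_cont.
    by rewrite even_derive1_0 mulr0.
  move=> t; have [_ C1] := Cv.
  apply: is_derive_eq (is_derive_mul (is_derive_pow d t) (CkS_dv t C1)) _.
  rewrite lap_mean -/v1 -/v2 [v1 t]derive1_mean; case: d el cl => [|e] _ _ /=.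
    by rewrite !mul0r expr0; ring.
  by rewrite exprS; ring.
by rewrite exprS; field; rewrite x0 expf_neq0.
Qed.

Lemma lap_scale d a : laplacian d.+1 (fun t => a * v t) = fun t => a * laplacian d.+1 v t.
Proof.
have [_ C1] := Cv.
have h1 : derive1 (fun t => a * v t) = fun t => a * v1 t.
  by apply/funext => t; apply: derive1_val; apply: is_derive_scale; exact: CkS_dv Cv.
have h2 : derive1 (fun t => a * v1 t) = fun t => a * v2 t.
  by apply/funext => t; apply: derive1_val; apply: is_derive_scale; exact: CkS_dv C1.
apply/funext => t; rewrite /laplacian /= h1 h2 -/v1 -/v2.
by move: (v2 t) (v2 0) (v1 t) => y z w; case: eqP => _; clear; ring.
Qed.

End EvenC2.

End RadialInverse.

(** * The linear polyharmonic problem *)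

Section Iterates.
Context {R : realType} (d : nat).
Implicit Types (f g h v : R -> R) (a b c x y s t r : R) (k p j : nat) (e : nat -> R).

Definition iter_invlap k f : R -> R := iter k (invlap d) f.

(** The radial monomial r^(2k), scaled so that the Laplacian takes each one to
    the previous one. *)
Definition monomial k : R -> R := iter_invlap k (fun=> 1).

Lemma iter_invlap_even_cont k f : even_cont f -> even_cont (iter_invlap k f).
Proof. by move=> ef; elim: k => // k ih; exact: invlap_even_cont. Qed.

Lemma iter_invlapS k f : iter_invlap k.+1 f = invlap d (iter_invlap k f).
Proof. by []. Qed.

Lemma iter_invlap_le_on k f g s : even_cont f -> even_cont g -> 0 <= s ->
  (forall t, 0 <= t <= s -> f t <= g t) -> iter_invlap k f s <= iter_invlap k g s.
Proof.
move=> ef eg; elim: k s => [|k ih] s s0 fg; first by apply: fg; rewrite s0 lexx.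
rewrite !iter_invlapS; apply: invlap_le_on => //;
  [by case: (iter_invlap_even_cont k ef)|by case: (iter_invlap_even_cont k eg)|].
move=> t /andP[t0 ts]; apply: ih => // u /andP[u0 ut]; apply: fg.
by rewrite u0 (le_trans ut).
Qed.

Lemma iter_invlap_le k f g : even_cont f -> even_cont g -> (forall t, f t <= g t) ->
  forall t, iter_invlap k f t <= iter_invlap k g t.
Proof.
move=> ef eg fg t; rewrite -(even_cont_norm t (iter_invlap_even_cont k ef))
  -(even_cont_norm t (iter_invlap_even_cont k eg)).
by apply: iter_invlap_le_on.
Qed.

Lemma iter_invlap_lin k a b f g : even_cont f -> even_cont g ->
  iter_invlap k (fun t => a * f t + b * g t) = fun s => a * iter_invlap k f s + b *
    iter_invlap k g s.
Proof.
move=> ef eg; elim: k => // k ih; rewrite iter_invlapS ih invlap_lin//.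
  by case: (iter_invlap_even_cont k ef).
by case: (iter_invlap_even_cont k eg).
Qed.

Lemma iter_invlap_zero k : iter_invlap k (fun _ : R => 0) = fun=> 0.
Proof. by elim: k => // k ih; rewrite iter_invlapS ih invlap_zero. Qed.

Lemma iter_invlap_ge0 k f : even_cont f -> (forall t, 0 <= f t) ->
  forall t, 0 <= iter_invlap k f t.
Proof.
by move=> ef f0 t; have := @iter_invlap_le k _ _ (even_cont_const 0) ef f0 t;
  rewrite iter_invlap_zero.
Qed.

Lemma iter_invlap_increment_le k f g r s : even_cont f -> even_cont g -> 0 <= r -> r <= s ->
  (forall t, f t <= g t) ->
  iter_invlap k.+1 f s - iter_invlap k.+1 f r <= iter_invlap k.+1 g s - iter_invlap k.+1 g r.
Proof.
move=> ef eg r0 rs fg; rewrite !iter_invlapS; apply: invlap_increment_le => //.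
- by case: (iter_invlap_even_cont k ef).
- by case: (iter_invlap_even_cont k eg).
- by move=> t _; exact: iter_invlap_le.
Qed.

Lemma monomial_even_cont k : even_cont (monomial k).
Proof. by apply: iter_invlap_even_cont; exact: even_cont_const. Qed.

Lemma monomial_ge0 k t : 0 <= monomial k t.
Proof. by apply: iter_invlap_ge0 => //; exact: even_cont_const. Qed.

Lemma invlap_scale a f : continuous f ->
  invlap d (fun t => a * f t) = fun t => a * invlap d f t.
Proof.
move=> cf; have := @invlap_lin _ d a 0 f f cf cf.
have -> : (fun t => a * f t + 0 * f t) = (fun t => a * f t).
  by apply/funext => t; rewrite mul0r addr0.
by move=> ->; apply/funext => t; rewrite mul0r addr0.
Qed.

Lemma invlap_pow k : invlap d (fun t => t ^+ k) =
  fun t : R => ((k.+2 * (k + d).+1)%:R)^-1 * t ^+ k.+2.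
Proof.
have mk t : mean d (fun t => t ^+ k) t * t = (k + d).+1%:R^-1 * t ^+ k.+1.
  have [->|t0] := eqVneq t 0; first by rewrite !mulr0 expr0n/= mulr0.
  rewrite meanE//.
  have -> : moment d (fun t => t ^+ k) = fun t : R => (k + d).+1%:R^-1 * t ^+ (k + d).+1.
    apply: primitive_unique; first by apply: moment_integrand_cont; exact: cont_pow.
      by rewrite expr0n/= mulr0.
    move=> x; apply: is_derive_eq (is_derive_scale _ (is_derive_pow (k + d).+1 x)) _ => /=.
    by rewrite mulKf ?pnatr_eq0// exprD mulrC.
  have -> : t ^+ (k + d).+1 = t ^+ k * t ^+ d.+1 by rewrite -exprD addnS.
  by rewrite mulrA mulfK ?expf_neq0// [t ^+ k.+1]exprSr mulrA.
apply: primitive_unique; first by apply: idmean_cont; exact: cont_pow.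
  by rewrite expr0n/= mulr0.
move=> x; apply: is_derive_eq (is_derive_scale _ (is_derive_pow k.+2 x)) _ => /=.
by rewrite [x * _]mulrC mk natrM invfM [X in X * _]mulrC -mulrA mulKf ?pnatr_eq0.
Qed.

Definition monomial_coef k : R := \prod_(i < k) ((i.*2.+2 * (i.*2 + d).+1)%:R)^-1.

Lemma monomial_coef_gt0 k : 0 < monomial_coef k.
Proof. by apply: prodr_gt0 => i _; rewrite invr_gt0 ltr0n. Qed.

Lemma monomialE k t : monomial k t = monomial_coef k * t ^+ k.*2.
Proof.
elim: k t => [|k ih] t; first by rewrite /monomial_coef big_ord0 expr0 mulr1.
rewrite /monomial iter_invlapS -/(monomial k) (_ : monomial k = fun t => monomial_coef k
  * t ^+ k.*2); last exact/funext.
rewrite invlap_scale ?invlap_pow; last exact: cont_pow.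
by rewrite mulrA /monomial_coef big_ord_recr.
Qed.

(** The radial v with Delta^p v = f and Delta^k v (0) = e k for k < p. *)
Fixpoint polysol p e f : R -> R :=
  if p is p'.+1 then fun r => e 0%N + invlap d (polysol p' (fun i => e i.+1) f) r else f.

Lemma polysol_even_cont p e f : even_cont f -> even_cont (polysol p e f).
Proof.
move=> ef; elim: p e => // p ih e; apply: even_contD; first exact: even_cont_const.
exact: invlap_even_cont.
Qed.

Lemma sum_even_cont p (a : 'I_p -> R) (F : 'I_p -> R -> R) : (forall i, even_cont (F i)) ->
  even_cont (fun t => \sum_(i < p) a i * F i t).
Proof.
elim: p a F => [|p ih] a F eF.
  by rewrite (_ : (fun _ => _) = fun=> 0); [exact: even_cont_const|apply/funext => t;
    rewrite big_ord0].
rewrite (_ : (fun _ => _) = fun t => a ord0 * F ord0 t +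
    \sum_(i < p) a (lift ord0 i) * F (lift ord0 i) t); last first.
  by apply/funext => t; rewrite big_ord_recl.
by apply: even_contD; [exact: even_contZ|exact: ih].
Qed.

Lemma invlap_sum p (a : 'I_p -> R) (F : 'I_p -> R ->
  R) h : (forall i, even_cont (F i)) -> even_cont h ->
  invlap d (fun t => \sum_(i < p) a i * F i t + h t) =
  fun t => \sum_(i < p) a i * invlap d (F i) t + invlap d h t.
Proof.
elim: p a F h => [|p ih] a F h eF eh.
  rewrite (_ : (fun t => _ + h t) = h); last by apply/funext => t; rewrite big_ord0 add0r.
  by apply/funext => t; rewrite big_ord0 add0r.
rewrite (_ : (fun t => _ + h t) = fun t => a ord0 * F ord0 t + 1 *
    (\sum_(i < p) a (lift ord0 i) * F (lift ord0 i) t + h t)); last first.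
  by apply/funext => t; rewrite big_ord_recl mul1r addrA.
have eS : even_cont (fun t => \sum_(i < p) a (lift ord0 i) * F (lift ord0 i) t + h t).
  by apply: even_contD => //; exact: sum_even_cont.
rewrite invlap_lin; [|by case: (eF ord0)|by case: eS].
by apply/funext => t; rewrite ih// big_ord_recl mul1r addrA.
Qed.

Lemma polysol_sum p e f : even_cont f ->
  polysol p e f = fun t => \sum_(i < p) e i * monomial i t + iter_invlap p f t.
Proof.
move=> ef; elim: p e => [|p ih] e; first by apply/funext => t; rewrite big_ord0 add0r.
rewrite /= ih invlap_sum//; [|by move=> i;
  exact: monomial_even_cont|exact: iter_invlap_even_cont].
by apply/funext => t; rewrite big_ord_recl mulr1 addrA.
Qed.

Lemma polysol_Ck p e f : continuous f -> Ck p.*2 (polysol p e f).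
Proof.
move=> cf; elim: p e => // p ih e.
have := Ck_lin 1 1 (Ck_cst _ (e 0%N)) (invlap_Ck d (ih (fun i => e i.+1))).
by congr (Ck _ _); apply/funext => t /=; rewrite !mul1r.
Qed.

Lemma lap_polysol p e f : continuous f ->
  laplacian d.+1 (polysol p.+1 e f) = polysol p (fun i => e i.+1) f.
Proof. by move=> cf; rewrite lap_invlap//;
  exact: Ck_cont (polysol_Ck p (fun i => e i.+1) cf). Qed.

Lemma polysol_at0 p e f : continuous f -> polysol p.+1 e f 0 = e 0%N.
Proof. by move=> cf; rewrite /= invlap0 ?addr0//;
  exact: Ck_cont (polysol_Ck p (fun i => e i.+1) cf). Qed.

Lemma derive1_polysol_0 p e f : continuous f -> derive1 (polysol p.+1 e f) 0 = 0.
Proof.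
move=> cf; rewrite derive1_invlap; last exact: Ck_cont (polysol_Ck p (fun i => e i.+1) cf).
by rewrite mul0r.
Qed.

Lemma iter_lap_polysol j p e f : continuous f -> (j <= p)%N ->
  iter j (laplacian d.+1) (polysol p e f) = polysol (p - j) (fun i => e (i + j)%N) f.
Proof.
move=> cf; elim: j => [|j ih] jp.
  by rewrite subn0; congr (polysol _ _ f); apply/funext => i; rewrite addn0.
rewrite /= ih 1?ltnW// subnS; case: (p - j)%N (subn_gt0 j p) => [|k _]; first by rewrite jp.
by rewrite lap_polysol//; congr (polysol _ _ f); apply/funext => i; rewrite addnS.
Qed.

End Iterates.

(** * Integral form of the Cauchy problem *)

Section Bridge.
Context {R : realType} (d : nat).
Implicit Types (f g h u v : R -> R) (k p j m : nat) (e : nat -> R).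

Local Notation lap := (laplacian d.+1).

(** The Cauchy problem on the half-line in integral form. *)
Definition entire_data m e :=
  exists u, even_cont u /\ u = polysol d m e (fun t => expR (u t)).

Definition data_seq p (alpha : R) (beta : 'rV[R]_p) (k : nat) : R :=
  if k is k'.+1 then oapp (beta 0) 0 (insub k') else alpha.

Lemma data_seqS p alpha (beta : 'rV[R]_p) (i : 'I_p) : data_seq alpha beta i.+1 = beta 0 i.
Proof. by rewrite /= valK. Qed.

Lemma polysol_snoc p e f : polysol d p.+1 e f = polysol d p e (fun t => e p + invlap d f t).
Proof.
elim: p e => // p ih e; apply/funext => t.
by rewrite -[LHS]/(e 0%N + invlap d (polysol d p.+1 (fun i => e i.+1) f) t) ih.
Qed.

Lemma is_Ck_CkP k u : is_Ck k +oo%E u <-> Ck k u.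
Proof.
elim: k u => [|k ih] u.
  split; first by move=> h r; have [_ /(_ 0%N)] := h r (ltry _); apply.
  by move=> cu r _; split=> // -[|//] _; exact: cu.
have ds j : derive1n j.+1 u = derive1n j (derive1 u) by rewrite derive1Sn.
split.
  move=> h; split; first by move=> x; have [h1 _] := h x (ltry _); exact: (h1 0%N).
  apply/ih => r rT; have [h1 h2] := h r rT; split=> j jk; rewrite -ds.
    exact: h1.
  exact: h2.
move=> [du /ih hu] r rT; have [h1 h2] := hu r rT; split=> -[|j] jk.
- exact: du.
- by rewrite ds; exact: h1.
- exact/differentiable_continuous/derivable1_diffP.
- by rewrite ds; exact: h2.
Qed.

(** The iterates of - Delta and Delta differ by a sign, which is 1 for an even
    number of iterations.  Regularity is needed for the Laplacian, defined
    through derivatives that may not exist, to be homogeneous. *)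
Lemma iter_opp_lap u k :
  (forall j, (j < k)%N -> (forall t, iter j lap u (- t) = iter j lap u t) /\ Ck 2 (iter j
    lap u)) ->
  iter k (fun v s => - lap v s) u = fun t => (-1) ^+ k * iter k lap u t.
Proof.
elim: k => [|k ih] h; first by apply/funext => t; rewrite expr0 mul1r.
rewrite /= ih; last by move=> j jk; apply: h; exact: ltnW.
have [ek Ck2] := h k (ltnSn k).
by apply/funext => t; rewrite (lap_scale Ck2) exprS mulN1r mulNr.
Qed.

Lemma iter_lap_reg m u : (forall t, u (- t) = u t) -> Ck m.*2 u ->
  forall j, (j <= m)%N ->
  (forall t, iter j lap u (- t) = iter j lap u t) /\ Ck (m - j).*2 (iter j lap u).
Proof.
move=> eu Cu; elim=> [|j ih] jm; first by rewrite subn0.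
have [ej Cj] := ih (ltnW jm).
have e : (m - j).*2 = ((m - j.+1).*2).+2 by rewrite -doubleS subnSK.
rewrite e in Cj; split; last exact: lap_Ck.
by case: (lap_even_cont ej Cj d).
Qed.

(** One level at a time, each Delta^k u is recovered from Delta^(k+1) u by
    [invlap_lap]. *)
Lemma polysol_of_iter_lap m e u : even_cont u -> Ck m.*2 u ->
  (forall k, (k < m)%N -> iter k lap u 0 = e k) ->
  forall k, (k <= m)%N -> u = polysol d k e (iter k lap u).
Proof.
move=> [eu cu] Cu he; elim=> // k ih km; rewrite polysol_snoc -he//.
have [ek Ckk] := iter_lap_reg eu Cu (ltnW km).
have e' : (m - k).*2 = ((m - k.+1).*2).+2 by rewrite -doubleS subnSK.
by rewrite {1}(ih (ltnW km)) {1}(invlap_lap ek (k := (m - k.+1).*2) _ d) -?e'.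
Qed.

(** From the differential to the integral form one recovers each level by
    [invlap_lap].  Conversely K gains two derivatives, so that a merely
    continuous fixed point is of class C^(2m). *)
Lemma global_dataP p alpha (beta : 'rV[R]_(p.+2.-2.+1)) : ~~ odd p.+2 ->
  global_data p.+2 d.+1 alpha beta <-> entire_data p.+2 (data_seq alpha beta).
Proof.
move=> ev; set m := p.+2; set e := data_seq alpha beta.
split.
  move=> [u [[_ [eu /is_Ck_CkP Cu] sol [u0 _] ub] _]]; rewrite mul2n in Cu.
  have cu := Ck_cont Cu; exists u; split=> //.
  have he k : (k < m)%N -> iter k lap u 0 = e k.
    case: k => [|k] km; first by [].
    by have [ubk _] := ub (Ordinal (km : (k < p.+1)%N));
      rewrite -[RHS](data_seqS alpha beta (Ordinal (km : (k < p.+1)%N))) in ubk *;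
      rewrite [LHS]ubk.
  have reg := iter_lap_reg eu Cu.
  rewrite {1}(polysol_of_iter_lap (conj eu cu) Cu he (leqnn m)); congr polysol;
    apply/funext => t.
  have em : forall t, iter m lap u (- t) = iter m lap u t by case: (reg m (leqnn m)).
  have solE s : 0 <= s -> iter m lap u s = expR (u s).
    move=> s0; rewrite -(sol s s0 (ltry _)) iter_opp_lap.
      by rewrite -signr_odd (negbTE ev) expr0 mul1r.
    move=> j jm; have [ej Cj] := reg j (ltnW jm); split=> //.
    by apply: Ck_leq Cj; rewrite -(subnSK jm) doubleS.
  have [t0|/ltW t0] := leP 0 t; first exact: solE.
  by rewrite -em -eu solE// oppr_ge0.
move=> [u [[eu cu] uE]]; exists u; split; last by move=> v T'; rewrite leye_eq => /eqP.
have [ee ce] := even_cont_exp (conj eu cu).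
have Cu : Ck m.*2 u by rewrite uE; exact: polysol_Ck.
have lapE j : (j <= m)%N -> iter j lap u = polysol d (m - j) (fun i => e (i + j)%N) (fun
  t => expR (u t)).
  by move=> jm; rewrite {1}uE iter_lap_polysol.
split=> //.
- by split=> //; apply/is_Ck_CkP; rewrite mul2n.
- move=> r r0 _; rewrite iter_opp_lap.
    by rewrite -signr_odd (negbTE ev) expr0 mul1r lapE// subnn.
  move=> j jm; have [ej Cj] := iter_lap_reg eu Cu (ltnW jm); split=> //.
  by apply: Ck_leq Cj; rewrite -(subnSK jm) doubleS.
- by rewrite uE; split; [rewrite polysol_at0|rewrite derive1_polysol_0].
- move=> k; have km : (k.+1 < m)%N by rewrite /m ltnS.
  by rewrite lapE ?(ltnW km)// -(subnSK km) polysol_at0// derive1_polysol_0// add0n /e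
    data_seqS.
Qed.

End Bridge.

(** * Monotone iteration *)

Section MonotoneIteration.
Context {R : realType} (d : nat).
Implicit Types (f g h u v : R -> R) (k p j m : nat) (e : nat -> R).

Lemma polysol_le p e e' f f' : even_cont f -> even_cont f' -> (forall k, (k < p)%N ->
  e k <= e' k) ->
  (forall t, f t <= f' t) -> forall t, polysol d p e f t <= polysol d p e' f' t.
Proof.
move=> ef ef'; elim: p e e' => // p ih e e' ee ff t /=.
apply: lerD; first exact: ee.
by apply: invlap_le => [||s]; [exact: polysol_even_cont|exact: polysol_even_cont|apply:
  ih => // k kp; exact: ee].
Qed.

(** Dini: at each point of [0, r] some F i is close to f, hence on a
    neighbourhood, hence all later F j by monotonicity; conclude by
    compactness. *)
Lemma dini_on (F : nat -> R -> R) f r eps :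
  (forall j, continuous (F j)) -> continuous f ->
  (forall t i j, (i <= j)%N -> F i t <= F j t) ->
  (forall t, F ^~ t @ \oo --> f t) -> 0 < eps ->
  \forall j \near \oo, forall t, 0 <= t <= r -> f t <= eps + F j t.
Proof.
move=> cF cf mF Ff eps0.
have /compact_near_coveringP := @segment_compact R 0 r.
move=> /(_ nat \oo (fun j t => f t <= eps + F j t)) H.
have e4 : 0 < eps / 4 by rewrite divr_gt0.
have {}H : \forall j \near \oo, `[0, r]%classic `<=` (fun t => f t <= eps + F j t).
  apply: H => x _.
  have /cvgrPdist_le /(_ _ e4) [N _ HN] := Ff x.
  have := HN N (leqnn N).
  rewrite /= ler_norml => /andP[_ h0].
  have /cvgrPdist_le /(_ _ e4) h1 := cf x.
  have /cvgrPdist_le /(_ _ e4) h2 := cF N x.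
  near=> y j => /=.
  have : `|f x - f y| <= eps / 4 by near: y.
  have : `|F N x - F N y| <= eps / 4 by near: y.
  have /mF : (N <= j)%N by near: j; exists N.
  by move=> /(_ y); rewrite !ler_norml; lra.
by apply: filterS H => j Hj t t01; apply: Hj; rewrite /= in_itv.
Unshelve. all: by end_near. Qed.

(** On [0, |t|] one has f <= F j + eps from some j on, and K^k of the constant
    eps is eps times a monomial. *)
Lemma iter_invlap_cvg k (F : nat -> R -> R) f : (forall j, even_cont (F j)) -> even_cont f ->
  (forall t i j, (i <= j)%N -> F i t <= F j t) ->
  (forall t, F ^~ t @ \oo --> f t) ->
  forall t, (fun j => iter_invlap d k (F j) t) @ \oo --> iter_invlap d k f t.
Proof.
move=> eF ef mF Ff t; apply/cvgrPdist_le => eps eps0.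
have le_lim j s : F j s <= f s.
  apply: (ler_cvg_to (cvg_cst (F j s)) (Ff s)).
  by exists j => // i /= ji; exact: mF.
pose del := eps / (monomial d k t + 1).
have q1 : 0 < monomial d k t + 1 by rewrite ltr_wpDl// monomial_ge0.
have del0 : 0 < del by rewrite divr_gt0.
have := dini_on `|t| (fun j => (eF j).2) ef.2 mF Ff del0.
apply: filterS => j Hj.
have e1 := even_cont_const (1:R).
have h1 : iter_invlap d k (F j) t <= iter_invlap d k f t by apply: iter_invlap_le.
have h2 : iter_invlap d k f `|t| <= del * monomial d k `|t| + 1 * iter_invlap d k (F j) `|t|.
  rewrite -[X in _ <= X](_ : iter_invlap d k (fun s => del * (fun=> 1) s + 1 * F j s)
    `|t| = _); last first.
    by rewrite iter_invlap_lin.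
  apply: iter_invlap_le_on => //; first exact: even_cont_lin.
  by move=> s /Hj; rewrite mulr1 mul1r.
rewrite !even_cont_norm in h2; try exact: monomial_even_cont; try exact: iter_invlap_even_cont.
have h3 : del * monomial d k t <= eps.
  by rewrite /del mulrAC ler_pdivrMr// ler_pM2l// lerDl.
rewrite ger0_norm ?subr_ge0//; lra.
Qed.

(** The increments of all K^(k+1) (F j) are controlled by those of the
    continuous function K^(k+1) G, a modulus of continuity that passes to the
    limit. *)
Lemma iter_invlap_limit_cont k (F : nat -> R -> R) G : (forall j, even_cont (F j)) ->
  even_cont G ->
  (forall t i j, (i <= j)%N -> F i t <= F j t) -> (forall j t, 0 <= F j t <= G t) ->
  exists g, even_cont g /\ forall t, (fun j => iter_invlap d k.+1 (F j) t) @ \oo --> g t.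
Proof.
move=> eF eG mF FG; pose W j t := iter_invlap d k.+1 (F j) t.
have eW j : even_cont (W j) by exact: iter_invlap_even_cont.
have cW t : W ^~ t @ \oo --> sup (range (W ^~ t)).
  apply: nondecreasing_cvgn.
    by move=> i j ij; apply: iter_invlap_le => // s; exact: mF.
  exists (iter_invlap d k.+1 G t) => _ [j _ <-]; apply: iter_invlap_le => // s.
  by have /andP[] := FG j s.
exists (fun t => sup (range (W ^~ t))); split; last exact: cW.
set g := fun t => _; have eg t : g (- t) = g t.
  rewrite /g (_ : W ^~ (- t) = W ^~ t)//.
  by apply: funext => j; case: (eW j) => ->.
have gn t : g `|t| = g t by case: ger0P => // _; rewrite eg.
pose H := iter_invlap d k.+1 G; have eH : even_cont H by exact: iter_invlap_even_cont.
have mod r s : 0 <= r -> r <= s -> 0 <= g s - g r <= H s - H r.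
  move=> r0 rs; have c : (fun j => W j s - W j r) @ \oo --> g s - g r by exact: cvgB.
  apply/andP; split.
    apply: (ler_cvg_to (cvg_cst 0) c); apply: nearW => j.
    have := @iter_invlap_increment_le _ d k _ _ r s (even_cont_const 0) (eF j) r0 rs.
    rewrite iter_invlap_zero subrr; apply=> t; by have /andP[] := FG j t.
  apply: (ler_cvg_to c (cvg_cst (H s - H r))); apply: nearW => j.
  by apply: iter_invlap_increment_le => // t; have /andP[] := FG j t.
have modn x y : `|g x - g y| <= `|H x - H y|.
  rewrite -(gn x) -(gn y) -(even_cont_norm x eH) -(even_cont_norm y eH).
  wlog xy : x y / `|y| <= `|x|.
    move=> wl; have [|/ltW] := leP `|y| `|x|; first exact: wl.
    by move=> h; rewrite distrC [X in _ <= X]distrC; exact: wl.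
  have /andP[h1 h2] := mod _ _ (normr_ge0 y) xy.
  by rewrite (ger0_norm h1); apply: le_trans h2 _; exact: ler_norm.
split=> // x; apply/cvgrPdist_le => eps eps0.
have /cvgrPdist_le /(_ _ eps0) := eH.2 x.
by apply: filterS => y; apply: le_trans.
Qed.

(** The iteration F 0 = 0, F (j+1) = exp (P_(E j) + K^m (F j)) increases, and
    F j <= exp (U i) for i >= j because E j <= E i and U i is a supersolution.
    So the limit exists, and it is continuous by [iter_invlap_limit_cont].
    A constant sequence E is the method of supersolutions; an increasing one
    gives closedness under increasing limits of data. *)
Lemma entire_data_of_supersolutions m e (E : nat -> nat -> R) (U : nat -> R -> R) Q :
  (0 < m)%N -> 
  (forall k i j, (k < m)%N -> (i <= j)%N -> E i k <= E j k) ->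
  (forall k, (k < m)%N -> E ^~ k @ \oo --> e k) ->
  (forall j, even_cont (U j)) -> even_cont Q -> (forall j t, U j t <= Q t) ->
  (forall j t, polysol d m (E j) (fun s => expR (U j s)) t <= U j t) ->
  entire_data d m e.
Proof.
case: m => // m _ mE cE eU eQ UQ sup.
pose F := fix F j := if j is j'.+1 then fun t => expR (polysol d m.+1 (E j') (F j') t)
  else (fun _ : R => 0).
have eF j : even_cont (F j) by elim: j => [|j ih];
  [exact: even_cont_const|apply: even_cont_exp; exact: polysol_even_cont].
have F0 j t : 0 <= F j t by case: j => // j; exact: expR_ge0.
have FS j t : F j t <= F j.+1 t.
  elim: j t => [|j ih] t; first exact: F0.
  by rewrite ler_expR; apply: (polysol_le (eF j) (eF j.+1)) => // k km; exact: mE.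
have mF t i j : (i <= j)%N -> F i t <= F j t.
  by elim: j => [|j ih]; [rewrite leqn0 => /eqP ->|rewrite leq_eqVlt =>
    /predU1P[->//|/ih/le_trans]; exact].
have FU j i t : (j <= i)%N -> F j t <= expR (U i t).
  elim: j i t => [|j ih] i t ji; first exact: expR_ge0.
  rewrite ler_expR; apply: le_trans (sup i t);
    apply: (polysol_le (eF j) (even_cont_exp (eU i))).
    by move=> k km; apply: mE => //; exact: ltnW.
  by move=> s; apply: ih; exact: ltnW.
have FQ j t : 0 <= F j t <= expR (Q t).
  by rewrite F0 (le_trans (FU j j t (leqnn j)))// ler_expR.
have [g [eg cg]] := iter_invlap_limit_cont m eF (even_cont_exp eQ) mF FQ.
pose u t := \sum_(i < m.+1) e i * monomial d i t + g t.
have eu : even_cont u by apply: even_contD => //; apply: sum_even_cont => i;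
  exact: monomial_even_cont.
have cF t : F ^~ t @ \oo --> expR (u t).
  rewrite -cvg_shiftS.
  have cw : (fun j => polysol d m.+1 (E j) (F j) t) @ \oo --> u t.
    under eq_fun do rewrite polysol_sum//.
    apply: cvgD; last exact: cg.
    apply: (cvg_big (op := +%R)) => [|i _]; first exact: add_continuous.
    by apply: cvgMr_tmp; exact: cE.
  have := @continuous_cvg _ _ _ _ _ (fun j => polysol d m.+1 (E j) (F j) t) expR (u t)
    (@continuous_expR R (u t)) cw.
  exact.
exists u; split=> //; rewrite polysol_sum; last exact: even_cont_exp.
apply/funext => t; congr (_ + _).
apply: (cvg_unique _ (cg t)) => //.
by apply: iter_invlap_cvg => //; exact: even_cont_exp.
Qed.

End MonotoneIteration.

(** * Growth of solutions of radial inequalities *)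

Section Growth.
Context {R : realType} (d : nat).
Implicit Types (f g h u v w y : R -> R) (k p j m N : nat) (e : nat -> R) (a c r s t : R).

(** The lower bound a t^(N+1) - C obtained by integration is at least half its
    leading term for large t. *)
Lemma increment_growth y g a r0 N : 0 <= r0 -> 0 < a ->
  (forall t, r0 <= t -> is_derive t (1:R) y (g t)) ->
  (forall t, r0 <= t -> a * N.+1%:R * t ^+ N <= g t) ->
  exists2 r1, r0 <= r1 /\ 1 <= r1 & forall t, r1 <= t -> a / 2 * t ^+ N.+1 <= y t.
Proof.
move=> r00 a0 dy gy; pose C := a * r0 ^+ N.+1 - y r0.
(* t >= 1 gives t <= t^(N+1), and t >= 2 C / a gives C <= a/2 * t^(N+1) *)
exists (Num.max r0 (Num.max 1 (2 * C / a))); first by rewrite !le_max !lexx ?orbT.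
move=> t; rewrite !ge_max => /and3P[rt t1 Ct].
have h : y r0 - a * r0 ^+ N.+1 <= y t - a * t ^+ N.+1.
  have dD s : r0 <= s -> is_derive s (1:R) (fun t => y t - a * t ^+ N.+1) (g s - a *
    (N.+1%:R * s ^+ N)).
    by move=> rs; exact: is_derive_sub (dy s rs) (is_derive_scale a (is_derive_pow N.+1 s)).
  apply: (nondecreasing_of_derive (f := fun t => y t - a * t ^+ N.+1)
    (g := fun s => g s - a * (N.+1%:R * s ^+ N))) rt.
  - by move=> s /andP[rs _]; exact: is_derive_continuous (dD s rs).
  - by move=> s /andP[/ltW rs _]; exact: dD.
  - by move=> s /andP[/ltW rs _]; rewrite subr_ge0 mulrA; exact: gy.
have ht : t <= t ^+ N.+1 by rewrite exprS ler_peMr ?exprn_ege1// (le_trans ler01).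
have : 2 * C <= a * t ^+ N.+1.
  rewrite mulrC; rewrite -ler_pdivrMl// in Ct *; rewrite [_^-1 * _]mulrC.
  by rewrite (le_trans _ ht)// [C * 2]mulrC.
by rewrite /C; lra.
Qed.

Lemma idmean_moment w t : t != 0 -> t * mean d w t = moment d w t / t ^+ d.
Proof.
by move=> t0; rewrite meanE// exprS; field; rewrite t0 expf_neq0.
Qed.

Lemma invlap_growth w a c r0 j : continuous w -> 0 <= r0 -> 0 < a ->
  (forall t, r0 <= t -> a * t ^+ j <= w t) ->
  exists a' r1, [/\ 0 < a', r0 <= r1 & forall t, r1 <= t ->
    0 <= t * mean d w t /\ a' * t ^+ j.+2 <= c + invlap d w t].
Proof.
move=> cw r00 a0 aw; pose N := (d + j)%N; pose a1 := a / N.+1%:R.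
have a10 : 0 < a1 by rewrite divr_gt0.
have [|r1 [r01 r11] Hy] := @increment_growth (moment d w) (fun t => t ^+ d * w t) a1 r0 N
  r00 a10 (fun t _ => is_derive_moment d t cw).
  move=> t rt; rewrite divfK ?pnatr_eq0// exprD mulrCA ler_wpM2l ?exprn_ge0 ?(le_trans r00)//.
  exact: aw.
pose a2 := a1 / 2; have a20 : 0 < a2 by rewrite divr_gt0.
have Hv t : r1 <= t -> a2 * t ^+ j.+1 <= t * mean d w t.
  move=> rt; have t0 : 0 < t by apply: lt_le_trans rt; exact: lt_le_trans r11.
  rewrite idmean_moment ?gt_eqF// ler_pdivlMr ?exprn_gt0// -mulrA -exprD addSn addnC.
  exact: Hy.
have d0 t : r1 <= t -> 0 <= t * mean d w t.
  move=> rt; apply: le_trans (Hv t rt).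
  apply: mulr_ge0; first exact: ltW.
  by apply: exprn_ge0; apply: le_trans rt; exact: le_trans r01.
have [||r2 [r12 r21] Hk] := @increment_growth (fun t => c + invlap d w t) (fun t => t *
  mean d w t) (a2 / j.+2%:R) r1 j.+1 (le_trans r00 r01) (divr_gt0 a20 (ltr0Sn _ _)).
- by move=> t _; apply: is_derive_eq (is_derive_add (is_derive_const c t)
  (is_derive_invlap d t cw)) _; rewrite add0r.
- by move=> t rt; rewrite divfK ?pnatr_eq0//; exact: Hv.
exists (a2 / j.+2%:R / 2), r2; split; first by rewrite !divr_gt0.
  exact: le_trans r12.
move=> t rt; split; last exact: Hk.
by apply: d0; exact: le_trans rt.
Qed.

(** The loss 2^-d comes from (r/s)^d >= 2^-d for r <= s <= r + 1 and r >= 1.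
    It does not depend on r: the estimate will be used on infinitely many
    intervals. *)
Lemma invlap_local_growth w r C j : continuous w -> 1 <= r -> 0 <= C ->
  (forall t, r <= t <= r + 1 -> C * (t - r) ^+ j <= w t) ->
  0 <= r * mean d w r ->
  forall t, r <= t <= r + 1 ->
   C * (2^-1 ^+ d / (j.+1 * j.+2)%:R) * (t - r) ^+ j.+2 <= invlap d w t - invlap d w r.
Proof.
move=> cw r1 C0 Cw yr t /andP[rt tr].
have r0 : 0 < r by exact: lt_le_trans r1.
have dp k s : is_derive s (1:R) (fun t => (t - r) ^+ k.+1) (k.+1%:R * (s - r) ^+ k).
  have h := @is_derive1_comp R (fun x => x ^+ k.+1) (fun t => t - r) s _ _
    (is_derive_pow k.+1 (s - r)) (is_derive_sub (is_derive_id s (1:R)) (is_derive_const r s)).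
  by apply: is_derive_eq h _; rewrite subr0 mulr1.
have Hy s : r <= s <= r + 1 -> r ^+ d * C / j.+1%:R * (s - r) ^+ j.+1 <= moment d w s.
  move=> /andP[rs sr].
  have dD x : is_derive x (1:R) (fun x => moment d w x - r ^+ d * C / j.+1%:R * (x - r)
    ^+ j.+1)
      (x ^+ d * w x - r ^+ d * C / j.+1%:R * (j.+1%:R * (x - r) ^+ j)).
    exact: is_derive_sub (is_derive_moment d x cw) (is_derive_scale _ (dp j x)).
  have : moment d w r - r ^+ d * C / j.+1%:R * (r - r) ^+ j.+1 <=
         moment d w s - r ^+ d * C / j.+1%:R * (s - r) ^+ j.+1.
    apply: (nondecreasing_of_derive (f :=
      fun x => moment d w x - r ^+ d * C / j.+1%:R * (x - r) ^+ j.+1)) rs.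
      by move=> x _; exact: is_derive_continuous (dD x).
    move=> x /andP[rx xs]; rewrite mulrA divfK ?pnatr_eq0// subr_ge0 -mulrA.
    have xr : r <= x <= r + 1 by rewrite ltW//= (le_trans (ltW xs)).
    apply: ler_pM; rewrite ?exprn_ge0 ?(ltW r0)//.
    + by rewrite mulr_ge0// exprn_ge0// subr_ge0 ltW.
    + by rewrite lerXn2r ?nnegrE ?(ltW r0)// ?(le_trans (ltW r0))// ltW.
    + exact: Cw.
  have yr' : 0 <= moment d w r.
    by move: yr; rewrite idmean_moment ?gt_eqF// pmulr_lge0 ?invr_gt0 ?exprn_gt0.
  rewrite subrr expr0n /= mulr0 subr0 => h.
  by rewrite -subr_ge0; exact: le_trans yr' h.
pose c1 := C * 2^-1 ^+ d / j.+1%:R.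
have Hv s : r <= s <= r + 1 -> c1 * (s - r) ^+ j.+1 <= s * mean d w s.
  move=> rs; have /andP[rs1 rs2] := rs; have s0 : 0 < s by exact: lt_le_trans rs1.
  rewrite idmean_moment ?gt_eqF// ler_pdivlMr ?exprn_gt0//.
  apply: le_trans (Hy s rs); rewrite mulrAC ler_wpM2r//.
    by rewrite exprn_ge0// subr_ge0.
  rewrite /c1 mulrAC ler_wpM2r ?invr_ge0// [r ^+ d * C]mulrC -mulrA ler_wpM2l//.
  rewrite -exprMn lerXn2r ?nnegrE ?mulr_ge0 ?invr_ge0 ?(ltW s0) ?(ltW r0)//.
  by lra.
pose c2 := c1 / j.+2%:R.
have dD x : is_derive x (1:R) (fun x => invlap d w x - c2 * (x - r) ^+ j.+2)
      (x * mean d w x - c2 * (j.+2%:R * (x - r) ^+ j.+1)).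
  exact: is_derive_sub (is_derive_invlap d x cw) (is_derive_scale _ (dp j.+1 x)).
have : invlap d w r - c2 * (r - r) ^+ j.+2 <= invlap d w t - c2 * (t - r) ^+ j.+2.
  apply: (nondecreasing_of_derive (f := fun x => invlap d w x - c2 * (x - r) ^+ j.+2)) rt.
    by move=> x _; exact: is_derive_continuous (dD x).
  move=> x /andP[rx xs]; rewrite mulrA divfK ?pnatr_eq0// subr_ge0.
  by apply: Hv; rewrite ltW//= (le_trans (ltW xs)).
rewrite subrr expr0n /= mulr0 subr0.
have -> : C * (2^-1 ^+ d / (j.+1 * j.+2)%:R) = c2.
  by rewrite /c2 /c1 natrM invfM !mulrA.
by move=> h; rewrite lerBrDl -lerBrDr.
Qed.

(** Move along the points r + 1 - 2^-j.  Each step is half as long as the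
    previous one, which divides s^N by 2^N only, while exp (u) is multiplied by
    e^N >= 2^N when u has grown by N.  So u grows by N at each step and is
    unbounded before r + 1. *)
Lemma no_fast_growth u r0 c N : (0 < N)%N -> 0 < c ->
  (forall r s, r0 <= r -> 0 <= s <= 1 -> u r + c * s ^+ N * expR (u r) <= u (r + s)) ->
  (forall L, exists2 r, r0 <= r & L <= u r) -> False.
Proof.
move=> N0 c0 step large.
(* e^L >= L makes the first step, of length 1/2, gain at least N *)
pose L := N%:R * 2 ^+ N / c.
have [r rr0 Lu] := large L.
have cL : N%:R <= c * 2^-1 ^+ N * expR L.
  have h : L <= expR L by apply: le_trans (expR_ge1Dx L); rewrite lerDr.
  have h2 : c * 2^-1 ^+ N * L <= c * 2^-1 ^+ N * expR L.
    by rewrite ler_wpM2l// mulr_ge0 ?exprn_ge0 ?invr_ge0// ltW.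
  apply: le_trans h2; rewrite /L exprVn.
  by rewrite [X in _ <= X](_ : _ = N%:R)//; field; rewrite gt_eqF//= expf_neq0.
pose A j := r + 1 - 2^-1 ^+ j.
have h01 j : 0 <= (2^-1 : R) ^+ j <= 1.
  by rewrite exprn_ge0 ?invr_ge0//= exprn_ile1 ?invr_ge0// invf_le1// ler1n.
have Ar j : r0 <= A j by rewrite /A; have /andP[_] := h01 j; lra.
have HA j : L + (N * j)%:R <= u (A j).
  elim: j => [|j ih]; first by rewrite muln0 addr0 /A expr0 addrK.
  have := step (A j) _ (Ar j) (h01 j.+1).
  have -> : A j + 2^-1 ^+ j.+1 = A j.+1 by rewrite /A exprS; lra.
  apply: le_trans; rewrite mulnS natrD addrCA addrC; apply: lerD => //.
  apply: (le_trans cL); rewrite -!mulrA ler_pM2l//.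
  have -> : (2^-1 : R) ^+ N * expR L = (2^-1 ^+ j.+1) ^+ N * (expR L * 2 ^+ (N * j)).
    rewrite -exprM mulSn exprD [(j * N)%N]mulnC -mulrA; congr (_ * _).
    by rewrite mulrCA -exprMn mulVf ?pnatr_eq0// expr1n mulr1.
  rewrite ler_wpM2l ?exprn_ge0 ?invr_ge0//.
  apply: le_trans (_ : expR (L + (N * j)%:R) <= _); last by rewrite ler_expR.
  rewrite expRD ler_wpM2l ?expR_ge0// -[(N * j)%:R]mulr1 expRM_natl lerXn2r ?nnegrE
    ?expR_ge0//.
  by have := expR_ge1Dx (1:R); lra.
have bd j : L + j%:R <= u (r + 1).
  apply: (@le_trans _ _ (L + (N * j)%:R)); first by rewrite lerD2l ler_nat leq_pmull.
  apply: le_trans (HA j) _.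
  have := step (A j) _ (Ar j) (h01 j); rewrite /A subrK; apply: le_trans.
  by rewrite lerDl !mulr_ge0 ?expR_ge0 ?exprn_ge0 ?invr_ge0// ltW.
have := bd (Num.bound `|u (r + 1) - L|).
have := archi_boundP (normr_ge0 (u (r + 1) - L)).
have := ler_norm (u (r + 1) - L); lra.
Qed.

End Growth.

(** * Blow-up *)

Section BlowUp.
Context {R : realType} (d : nat).
Implicit Types (f g u v w y : R -> R) (k p j m N : nat) (e : nat -> R) (a c r s t : R).

Local Notation sh e := (fun i => e i.+1).

(** All levels Delta^k v of v = polysol d p e w are nonnegative and nondecreasing
    from r0 on (w itself only nonnegative). *)
Fixpoint rising p e w r0 : Prop :=
  if p is p'.+1 then
    (forall t, r0 <= t -> 0 <= polysol d p e w t /\ 0 <= t * mean d (polysol d p' (sh e) w) t)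
    /\ rising p' (sh e) w r0
  else forall t, r0 <= t -> 0 <= w t.

Lemma rising_le p e w r0 r1 : r0 <= r1 -> rising p e w r0 -> rising p e w r1.
Proof.
move=> r01; elim: p e => [|p ih] e /=; first by move=> h t rt; apply: h; exact: le_trans rt.
by move=> [h1 /ih h2]; split=> // t rt; apply: h1; exact: le_trans rt.
Qed.

Lemma polysol_growth p e w r0 a j : even_cont w -> 0 <= r0 -> 0 < a ->
  (forall t, r0 <= t -> a * t ^+ j <= w t) ->
  exists a' r1, [/\ 0 < a', r0 <= r1, rising p e w r1 &
    forall t, r1 <= t -> a' * t ^+ (j + p.*2) <= polysol d p e w t].
Proof.
move=> ew r00 a0 aw; elim: p e => [|p ih] e.
  exists a, r0; split=> // t rt; last by rewrite addn0; exact: aw.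
  apply: le_trans (aw t rt); apply: mulr_ge0; first exact: ltW.
  by apply: exprn_ge0; exact: le_trans rt.
have [a1 [r1 [a10 r01 up h]]] := ih (sh e).
have r10 := le_trans r00 r01.
have [a2 [r2 [a20 r12 h2]]] := invlap_growth d (e 0%N) (polysol_even_cont d p (sh e)
  ew).2 r10 a10 h.
exists a2, r2; split=> //; first exact: le_trans r12.
  split; last exact: rising_le up.
  move=> t rt; have [h3 h4] := h2 t rt; split=> //.
  apply: le_trans h4; apply: mulr_ge0; first exact: ltW.
  by apply: exprn_ge0; apply: le_trans rt; exact: le_trans r12.
by move=> t rt; rewrite doubleS !addnS; have [_] := h2 t rt.
Qed.

Lemma rising_ge0 p e w r0 t : rising p e w r0 -> r0 <= t -> 0 <= polysol d p e w t.
Proof. by case: p => [|p] /=; [move=> h /h|move=> [h _] /h[]]. Qed.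

(** The constant c depends on p, j and d but not on the starting point r, as
    [no_fast_growth] demands. *)
Lemma polysol_local_growth p e w r0 j : even_cont w -> rising p e w r0 ->
  exists2 c, 0 < c & forall r C, r0 <= r -> 1 <= r -> 0 <= C ->
    (forall t, r <= t <= r + 1 -> C * (t - r) ^+ j <= w t - w r) ->
    forall t, r <= t <= r + 1 ->
      C * c * (t - r) ^+ (j + p.*2) <= polysol d p e w t - polysol d p e w r.
Proof.
move=> ew; elim: p e => [|p ih] e up.
  by exists 1 => // r C _ _ _ h t rt; rewrite mulr1 addn0; exact: h.
have [up1 up2] := up; have [c c0 h] := ih _ up2.
exists (c * (2^-1 ^+ d / ((j + p.*2).+1 * (j + p.*2).+2)%:R)).
  by rewrite mulr_gt0// divr_gt0// exprn_gt0// invr_gt0.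
move=> r C rr r1 C0 hw t rt.
have e1 := polysol_even_cont d p (sh e) ew.
have [_ d0] := up1 r rr.
have := @invlap_local_growth _ d _ r (C * c) (j + p.*2) e1.2 r1 _ _ d0 t rt.
rewrite doubleS !addnS /= opprD addrACA subrr add0r mulrA; apply.
  by rewrite mulr_ge0// ltW.
move=> s rs; apply: le_trans (h r C rr r1 C0 hw s rs) _.
by rewrite lerBlDr lerDl; exact: rising_ge0 up2 rr.
Qed.

(** Otherwise w = Delta^(p+1) u, which is nondecreasing, is bounded below by a
    positive constant from r on, and all levels below it tend to infinity.
    Integrating exp (u) >= exp (u s) on [s, s + 1] through all levels yields the
    inequality that [no_fast_growth] excludes. *)
Lemma entire_level_le0 p e u : even_cont u -> u = polysol d p.+2 e (fun t => expR (u t)) ->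
  forall r, 0 <= r -> e p.+1 + invlap d (fun t => expR (u t)) r <= 0.
Proof.
move=> eu uE r r00; set f := fun t => expR (u t).
have ef : even_cont f by exact: even_cont_exp.
rewrite leNgt; apply/negP => w0.
pose w t := e p.+1 + invlap d f t.
have ew : even_cont w by apply: even_contD; [exact: even_cont_const|exact: invlap_even_cont].
have uw : u = polysol d p.+1 e w by rewrite {1}uE polysol_snoc.
have hw t : r <= t -> w r * t ^+ 0 <= w t.
  move=> rt; rewrite expr0 mulr1 lerD2l; apply: invlap_nondecreasing => //; first exact: ef.2.
  by move=> s _; exact: expR_ge0.
have [a [r1 [a0 r01 up gu]]] := polysol_growth p.+1 e ew r00 w0 hw.
pose r2 := Num.max r1 1; have r12 : r1 <= r2 by rewrite le_max lexx.
have r21 : 1 <= r2 by rewrite le_max lexx orbT.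
have [c c0 hc] := polysol_local_growth 2 ew up.
pose c' := 2^-1 ^+ d / (1 * 2)%:R * c.
have u_nd s t : r2 <= s -> s <= t -> u s <= u t.
  move=> rs st; rewrite uw /= lerD2l.
  apply: (nondecreasing_of_derive (f := invlap d (polysol d p (sh e) w))
     (g := fun t => t * mean d (polysol d p (sh e) w) t)) st.
  - by move=> x _; exact: is_derive_continuous (is_derive_invlap d x (polysol_even_cont d
    p (sh e) ew).2).
  - by move=> x _; exact: is_derive_invlap (polysol_even_cont d p (sh e) ew).2.
  - move=> x /andP[sx _]; have [up1 _] := up.
    by have [] := up1 x (le_trans r12 (le_trans rs (ltW sx))).
apply: (@no_fast_growth R u r2 c' (2 + p.+1.*2)) => //.
- by rewrite /c' mulr_gt0// divr_gt0// exprn_gt0// invr_gt0.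
- move=> s h rs /andP[h0 h1].
  have s1 : 1 <= s by exact: le_trans rs.
  have sh : s <= s + h <= s + 1 by rewrite lerDl h0 lerD2l.
  have := hc s (expR (u s) * (2^-1 ^+ d / (1 * 2)%:R)) (le_trans r12 rs) s1 _ _ (s + h) sh.
  rewrite -uw [s + h - s]addrAC subrr add0r => H.
  rewrite -lerBrDl; apply: le_trans (H _ _).
  + rewrite /c' le_eqVlt; apply/orP; left; apply/eqP.
    by move: (2^-1 ^+ d / _) (h ^+ _) (expR _) => x y z; ring.
  + by rewrite mulr_ge0 ?expR_ge0// divr_ge0// exprn_ge0// invr_ge0.
  + move=> t st; rewrite opprD addrACA subrr add0r.
    have [/andP[st1 st2]] := conj st I => _.
    apply: (@invlap_local_growth _ d f s (expR (u s)) 0 ef.2 s1 (expR_ge0 _)) st.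
      move=> x /andP[sx _]; rewrite expr0 mulr1 ler_expR; exact: u_nd.
    apply: mulr_ge0; first exact: le_trans ler01 s1.
    have := @mean_le _ d (fun=> 0) f s (@cont_const R 0) ef.2 (le_trans ler01 s1).
    by rewrite mean_cst mul0r; apply=> x _; exact: expR_ge0.
- move=> L; pose t := Num.max r2 (L / a); exists t; first by rewrite le_max lexx.
  have rt : r2 <= t by rewrite le_max lexx.
  rewrite uw; apply: le_trans (gu t (le_trans r12 rt)).
  have t1 : 1 <= t by exact: le_trans rt.
  have Lt : L / a <= t by rewrite le_max lexx orbT.
  rewrite ler_pdivrMr// mulrC in Lt; apply: le_trans Lt _; rewrite ler_pM2l//.
  by rewrite doubleS !addnS exprS ler_peMr ?exprn_ege1// (le_trans ler01).
Qed.

Lemma moment_gt0 f r s : continuous f -> 0 <= r -> r < s ->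
  (forall t, 0 <= t <= s -> 0 <= f t) -> (forall t, r < t < s -> 0 < f t) ->
  0 < moment d f s.
Proof.
move=> cf r0 rs f0 fp.
have dy t := is_derive_moment d t cf.
have [c] := @MVT R (moment d f) (fun t => t ^+ d * f t) r s rs (fun x _ => dy x)
  (continuous_subspace_cc (fun t _ => is_derive_continuous (dy t))).
rewrite in_itv/= => /andP[rc cs] h.
have yr : 0 <= moment d f r.
  rewrite -(moment0 d cf).
  apply: (nondecreasing_of_derive (f := moment d f) (g := fun t => t ^+ d * f t)) r0 => x.
  - by move=> _; exact: is_derive_continuous (dy x).
  - move=> /andP[x0 xr]; rewrite mulr_ge0 ?exprn_ge0 ?(ltW x0)// f0//.
    by rewrite (ltW x0) (ltW (lt_trans xr rs)).
have : 0 < c ^+ d * f c * (s - r).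
  rewrite mulr_gt0 ?subr_gt0// mulr_gt0//; last by apply: fp; rewrite rc.
  by rewrite exprn_gt0// (le_lt_trans r0).
by rewrite -h; lra.
Qed.

(** Strict positivity propagates outwards: r^d (K f)' increases strictly near
    a point where f is positive and does not decrease elsewhere. *)
Lemma invlap_gt0 f r s : continuous f -> (forall t, 0 <= f t) -> 0 <= r -> 0 < f r ->
  r < s -> 0 < invlap d f s.
Proof.
move=> cf f0 r0 fr rs.
have [del del0 Hd] : exists2 del, 0 < del & forall t, r < t < r + del -> 0 < f t.
  have /cvgrPdist_lt /(_ _ fr) /nbhs_ballP[del /= del0 H] := cf r.
  exists del => // t /andP[rt td]; have := H t; rewrite /ball/= => /(_ _).
  rewrite ltr0_norm ?subr_lt0// => /(_ _)/ltr_normlP[]; first by rewrite opprB; lra.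
  by lra.
have dK t := is_derive_invlap d t cf.
pose r1 := Num.min s (r + del / 2).
have rr1 : r < r1 by rewrite lt_min rs ltrDl divr_gt0.
have [c] := @MVT R (invlap d f) (fun t => t * mean d f t) r s rs (fun x _ => dK x)
  (continuous_subspace_cc (fun t _ => is_derive_continuous (dK t))).
rewrite in_itv/= => /andP[rc cs] h.
have kr : 0 <= invlap d f r.
  have := @invlap_nondecreasing _ d f 0 r cf (lexx _) r0 (fun t _ => f0 t).
  by rewrite invlap0.
have c0 : 0 < c by exact: le_lt_trans rc.
have : 0 < c * mean d f c * (s - r).
  rewrite mulr_gt0 ?subr_gt0// idmean_moment ?gt_eqF// divr_gt0 ?exprn_gt0//.
  pose r2 := Num.min c (r + del).
  have rr2 : r < r2 by rewrite lt_min rc ltrDl.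
  apply: (@lt_le_trans _ _ (moment d f r2)).
    apply: (@moment_gt0 f r) => // t /andP[rt]; rewrite lt_min => /andP[_ td].
    by apply: Hd; rewrite rt.
  have r2c : r2 <= c by rewrite ge_min lexx.
  have dy t := is_derive_moment d t cf.
  apply: (nondecreasing_of_derive (f := moment d f) (g := fun t => t ^+ d * f t)) r2c => x.
  - by move=> _; exact: is_derive_continuous (dy x).
  - move=> /andP[x0 xr]; rewrite mulr_ge0 ?exprn_ge0 ?f0//.
    by apply: ltW; apply: le_lt_trans x0; apply: ltW; exact: le_lt_trans rr2.
by rewrite -h; lra.
Qed.

Lemma entire_data_last_lt0 p e : entire_data d p.+2 e -> e p.+1 < 0.
Proof.
move=> [u [eu uE]]; have := entire_level_le0 eu uE ler01.
have [_ cf] := even_cont_exp eu.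
have := @invlap_gt0 _ 0 1 cf (fun t => expR_ge0 _) (lexx 0) (expR_gt0 _) ltr01.
lra.
Qed.

(** For d <= 1 and t >= 1, (Delta^(p+1) u)' is at least y / t^d >= y / t, where
    y is the positive integral of t^d exp (u) over [0, 1]; so Delta^(p+1) u
    exceeds y ln t up to a constant and becomes positive. *)
Lemma entire_low_dim p e : (d <= 1)%N -> ~ entire_data d p.+2 e.
Proof.
move=> d1 [u [eu uE]]; have le0 := entire_level_le0 eu uE.
have [_ cf] := even_cont_exp eu; set f := fun t => expR (u t) in cf le0.
have f0 t : 0 <= f t by exact: expR_ge0.
have y1 : 0 < moment d f 1.
  by apply: (@moment_gt0 f 0) => // t _; exact: expR_gt0.
set y := moment d f 1 in y1.
have Hln t : 1 <= t -> invlap d f 1 + y * ln t <= invlap d f t.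
  move=> t1.
  have dD (x : R) : 1 <= x -> is_derive x (1:R) (fun t => invlap d f t - y * ln t) (x *
    mean d f x - y * x^-1).
    move=> x1; apply: is_derive_sub (is_derive_invlap d x cf) _; apply: is_derive_scale;
      apply: is_derive1_ln.
    exact: lt_le_trans x1.
  have : invlap d f 1 - y * ln 1 <= invlap d f t - y * ln t.
    apply: (nondecreasing_of_derive (f := fun t => invlap d f t - y * ln t)
      (g := fun x => x * mean d f x - y * x^-1)) t1 => x.
    - by move=> /andP[x1 _]; exact: is_derive_continuous (dD x x1).
    - by move=> /andP[/ltW x1 _]; exact: dD.
    - move=> /andP[x1 _]; rewrite subr_ge0; have x0 := lt_trans ltr01 x1.
      rewrite idmean_moment ?gt_eqF//.
      have dy z := is_derive_moment d z cf.
      have yx : y <= moment d f x.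
        apply: (nondecreasing_of_derive (f := moment d f) (g :=
          fun t => t ^+ d * f t)) (ltW x1) => z.
        - by move=> _; exact: is_derive_continuous (dy z).
        - by move=> /andP[/ltW z1 _]; apply: mulr_ge0 => //; apply: exprn_ge0;
          exact: le_trans ler01 z1.
      apply: ler_pM => //; [exact: ltW|by rewrite invr_ge0 ltW|].
      rewrite lef_pV2 ?posrE ?exprn_gt0//.
      by case: (d) d1 => [|[|]]// _; rewrite ?expr0 ?expr1// ltW.
  rewrite ln1; lra.
pose L := `|e p.+1| / y.
have K1 : 0 <= invlap d f 1 by have :=
  @invlap_nondecreasing _ d f 0 1 cf (lexx _) ler01 (fun t _ => f0 t); rewrite invlap0.
have L0 : 0 <= L by rewrite divr_ge0// ltW.
have E1 : 1 <= expR (L + 1) by have := expR_ge1Dx (L + 1); lra.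
have := Hln _ E1; rewrite expRK mulrDr mulr1 /L [y * _]mulrC divfK ?gt_eqF//.
have := le0 _ (le_trans ler01 E1); have := ler_norm (- e p.+1); rewrite normrN; lra.
Qed.

End BlowUp.

(** * Structure of the set of data of global solutions *)

Section EntireData.
Context {R : realType} (d : nat).
Implicit Types (f g u v w y : R -> R) (k p j m N : nat) (e : nat -> R) (a b c r s t : R).

Definition set_at e k c : nat -> R := fun i => if i == k then c else e i.

Lemma entire_data_of_supersolution m e U : (0 < m)%N -> even_cont U ->
  (forall t, polysol d m e (fun s => expR (U s)) t <= U t) -> entire_data d m e.
Proof.
move=> m0 eU sup.
apply: (@entire_data_of_supersolutions _ d m e (fun _ => e) (fun _ => U) U) => //.
by move=> k _; exact: cvg_cst.
Qed.

Lemma entire_data_le m e e' : (0 < m)%N -> (forall k, (k < m)%N -> e' k <= e k) ->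
  entire_data d m e -> entire_data d m e'.
Proof.
move=> m0 ee [u [eu uE]]; apply: (entire_data_of_supersolution m0 eu) => t.
rewrite [in X in _ <= X]uE.
by have ef := even_cont_exp eu; exact: (polysol_le d ef ef ee).
Qed.

(** Replacing Delta^(p+1) u <= 0 by 0 gives an upper bound that depends on the
    data e 0, ..., e p only, hence uniform when the last datum varies. *)
Lemma entire_le_barrier p e u : even_cont u -> u = polysol d p.+2 e (fun t => expR (u t)) ->
  forall t, u t <= polysol d p.+1 e (fun=> 0) t.
Proof.
move=> eu uE t; have ef := even_cont_exp eu.
rewrite uE polysol_snoc; have ew : even_cont (fun t => e p.+1 + invlap d (fun t => expR
  (u t)) t).
  by apply: even_contD; [exact: even_cont_const|exact: invlap_even_cont].
apply: (polysol_le d ew (even_cont_const 0)) => // s.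
by rewrite -(even_cont_norm s ew); exact: entire_level_le0 eu uE _ (normr_ge0 s).
Qed.

Lemma polysol_eq_on p e e' f : (forall k, (k < p)%N -> e k = e' k) ->
  polysol d p e f = polysol d p e' f.
Proof.
elim: p e e' => // p ih e e' ee /=.
by rewrite (ih _ (fun i => e' i.+1)) ?ee// => k kp; exact: ee.
Qed.

(** Solutions for the data with last entry decreased by 1/(j+1) lie below a
    common barrier. *)
Lemma entire_data_closed p e :
  (forall eps, 0 < eps -> entire_data d p.+2 (set_at e p.+1 (e p.+1 - eps))) ->
    entire_data d p.+2 e.
Proof.
move=> H; pose E j := set_at e p.+1 (e p.+1 - j.+1%:R^-1).
have HE j : exists u, even_cont u /\ u = polysol d p.+2 (E j) (fun t => expR (u t)).
  by apply: H; rewrite invr_gt0.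
have [U HU] := boolp.choice HE.
apply: (@entire_data_of_supersolutions _ d p.+2 e E U (polysol d p.+1 e (fun=> 0))) => //.
- move=> k i j _ ij; rewrite /E /set_at; case: eqP => // _.
  by rewrite lerD2l lerN2 lef_pV2 ?posrE// ler_nat.
- move=> k _; rewrite /E /set_at; case: eqP => [->|_]; last exact: cvg_cst.
  rewrite -[X in _ --> X]subr0; apply: cvgB; first exact: cvg_cst.
  exact: cvg_harmonic.
- by move=> j; case: (HU j).
- by apply: polysol_even_cont; exact: even_cont_const.
- move=> j t; have [eU UE] := HU j; have := entire_le_barrier eU UE t.
  rewrite (polysol_eq_on (e' := e))// => k kp; rewrite /E /set_at.
  by rewrite (ltn_eqF kp).
- by move=> j t; have [eU UE] := HU j; rewrite [in X in _ <= X]UE.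
Qed.

Lemma polysol_lin p a b e e' f f' : even_cont f -> even_cont f' ->
  polysol d p (fun i => a * e i + b * e' i) (fun t => a * f t + b * f' t) =
  fun t => a * polysol d p e f t + b * polysol d p e' f' t.
Proof.
move=> ef ef'; elim: p e e' => // p ih e e' /=.
rewrite ih invlap_lin.
- by apply/funext => t; ring.
- by case: (polysol_even_cont d p (fun i => e i.+1) ef).
- by case: (polysol_even_cont d p (fun i => e' i.+1) ef').
Qed.

Lemma expR_convex a b (x y : R) : 0 <= a -> 0 <= b -> a + b = 1 ->
  expR (a * x + b * y) <= a * expR x + b * expR y.
Proof.
move=> a0 b0 ab; pose z := a * x + b * y.
have h (w : R) : expR z * (1 + (w - z)) <= expR w.
  have -> : expR w = expR z * expR (w - z) by rewrite -expRD subrKC.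
  by rewrite ler_wpM2l ?expR_ge0// expR_ge1Dx.
have := lerD (ler_wpM2l a0 (h x)) (ler_wpM2l b0 (h y)).
apply: le_trans; rewrite -/z le_eqVlt; apply/orP; left; apply/eqP.
move: (expR z) => E; rewrite /z; have -> : b = 1 - a by lra.
by ring.
Qed.

(** By convexity of exp, the same convex combination of the two solutions is a
    supersolution. *)
Lemma entire_data_convex m e e' a b : (0 < m)%N -> 0 <= a -> 0 <= b -> a + b = 1 ->
  entire_data d m e -> entire_data d m e' -> entire_data d m (fun i => a * e i + b * e' i).
Proof.
move=> m0 a0 b0 ab [u [eu uE]] [v [ev vE]].
have eU : even_cont (fun t => a * u t + b * v t) by exact: even_cont_lin.
apply: (entire_data_of_supersolution m0 eU) => t.
have -> : a * u t + b * v t = polysol d m (fun i => a * e i + b * e' i) (fun t => a *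
  expR (u t) + b * expR (v t)) t.
  by rewrite polysol_lin; [rewrite -uE -vE|exact: even_cont_exp|exact: even_cont_exp].
apply: polysol_le => //; first exact: even_cont_exp.
  by apply: even_cont_lin; exact: even_cont_exp.
by move=> s; exact: expR_convex.
Qed.

Lemma polysol_zero_data p f : polysol d p (fun=> 0) f = iter_invlap d p f.
Proof.
elim: p => // p ih; apply/funext => t.
by rewrite -[LHS]/(0 + invlap d (polysol d p (fun=> 0) f) t) add0r ih.
Qed.

(** After the first K the function is bounded below by a positive constant, and
    each further K gains two powers of t. *)
Lemma iter_invlap_growth p f r : even_cont f -> (forall t, 0 <= f t) -> 0 <= r -> 0 < f r ->
  exists a r1, [/\ 0 < a, 0 < r1 & forall t, r1 <= t ->
    a * t ^+ p.*2 <= iter_invlap d p.+1 f t].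
Proof.
move=> ef f0 r0 fr; have r1 : 0 <= r + 1 by rewrite addr_ge0.
have k0 : 0 < invlap d f (r + 1) by apply: (invlap_gt0 d ef.2 f0 r0 fr); rewrite ltrDl.
have [|a [r2 [a0 r12 _ h]]] := @polysol_growth _ d p (fun=> 0) (invlap d f) (r + 1) _ 0
  (invlap_even_cont d ef) r1 k0.
  move=> t rt; rewrite expr0 mulr1; apply: invlap_nondecreasing => //; exact: ef.2.
exists a, r2; split=> //; first by apply: lt_le_trans r12; rewrite ltr_wpDl.
by move=> t rt; have := h t rt; rewrite polysol_zero_data add0n /iter_invlap iterSr.
Qed.

Lemma polysol_delta p k c f : (k < p)%N -> even_cont f ->
  polysol d p (fun i => if i == k then c else 0) f = fun t => c * monomial d k t +
    iter_invlap d p f t.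
Proof.
move=> kp ef; rewrite polysol_sum//; apply/funext => t; congr (_ + _).
rewrite (bigD1 (Ordinal kp))//= eqxx big1 ?addr0// => i.
by rewrite -val_eqE /= => /negbTE ->; rewrite mul0r.
Qed.

(** Let f be the convexity defect of exp at the solutions u and v, which is not
    identically 0 since the data differ.  Then U = (u + v)/2 satisfies
    P_mid + K^(p+2) f + K^(p+2) (e^U) = U, and it remains to see that
    K^(p+2) f + del * q_k >= eps * q_(p+1).  For large r the first term suffices,
    as it grows at least like r^(2p+2); on a bounded interval the second one
    does, as k <= p. *)
Lemma entire_data_strict p e e' k k0 del : (0 < k <= p)%N -> (k0 < p.+2)%N -> e k0 != e' k0 ->
  0 < del -> entire_data d p.+2 e -> entire_data d p.+2 e' ->
  exists2 eps, 0 < eps & entire_data d p.+2 (fun i => 2^-1 * e i + 2^-1 * e' i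
     - (if i == k then del else 0) + (if i == p.+1 then eps else 0)).
Proof.
move=> /andP[k1 kp] k0p ek0 del0 [u [eu uE]] [v [ev vE]].
pose m := p.+2.
have [r0 ur0] : exists r, u r != v r.
  apply: contrapT => H; have uv : u = v.
    by apply/funext => r; apply/eqP; apply: contrapT => /negP h; apply: H; exists r.
  have cf := (even_cont_exp eu).2.
  have key (e1 : nat -> R) : u = polysol d m e1 (fun t => expR (u t)) ->
    iter k0 (laplacian d.+1) u 0 = e1 k0.
    move=> {1}->; rewrite iter_lap_polysol// ?(ltnW k0p)//.
    by rewrite -(subnSK k0p) polysol_at0// add0n.
  have h1 := key _ uE; rewrite -uv in vE; have h2 := key _ vE.
  by move: ek0; rewrite -h1 -h2 eqxx.
pose f t := (expR (2^-1 * u t) - expR (2^-1 * v t)) ^+ 2 / 2.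
have ef : even_cont f.
  have eh : even_cont (fun t => expR (2^-1 * u t) - expR (2^-1 * v t)).
    rewrite (_ : (fun t => _) = fun t => 1 * expR (2^-1 * u t) + (-1) * expR (2^-1 * v
      t)); last first.
      by apply/funext => t; rewrite mul1r mulN1r.
    by apply: even_cont_lin; apply: even_cont_exp; exact: even_contZ.
  rewrite (_ : f = fun t => 2^-1 * ((expR (2^-1 * u t) - expR (2^-1 * v t)) * (expR (2^-1
    * u t) - expR (2^-1 * v t)))).
    by apply: even_contZ; exact: even_contM.
  by apply/funext => t; rewrite /f expr2 mulrC.
have f0 t : 0 <= f t by rewrite /f divr_ge0// sqr_ge0.
have fr0 : 0 < f `|r0|.
  rewrite (even_cont_norm r0 ef) /f divr_gt0// exprn_even_gt0//= subr_eq0.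
  by apply: contra ur0 => /eqP/expR_inj; move=> h; apply/eqP; lra.
have [a [r1 [a0 r10 Ha]]] := iter_invlap_growth p.+1 ef f0 (normr_ge0 r0) fr0.
pose C1 := monomial_coef d p.+1 : R; pose C2 := monomial_coef d k : R.
have C10 : 0 < C1 by exact: monomial_coef_gt0.
have C20 : 0 < C2 by exact: monomial_coef_gt0.
pose B := C1 * r1 ^+ (p.+1.*2 - k.*2).
have B0 : 0 < B by rewrite mulr_gt0// exprn_gt0.
pose eps := Num.min (a / C1) (del * C2 / B).
have eps0 : 0 < eps by rewrite lt_min !divr_gt0// mulr_gt0.
exists eps => //.
pose U t := 2^-1 * u t + 2^-1 * v t.
have eU : even_cont U by exact: even_cont_lin.
apply: (@entire_data_of_supersolution m _ U) => // t.
pose D i : R := (if i == k then del else 0) - (if i == p.+1 then eps else 0).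
have avg s : 2^-1 * expR (u s) + 2^-1 * expR (v s) - f s = expR (U s).
  rewrite /f /U expRD.
  have -> : expR (u s) = expR (2^-1 * u s) ^+ 2 by rewrite -expRM_natl; congr expR; lra.
  have -> : expR (v s) = expR (2^-1 * v s) ^+ 2 by rewrite -expRM_natl; congr expR; lra.
  by field.
have ea : even_cont (fun s => 2^-1 * expR (u s) + 2^-1 * expR (v s)).
  by apply: even_cont_lin; exact: even_cont_exp.
have -> : (fun i => 2^-1 * e i + 2^-1 * e' i - (if i == k then del else 0) + (if i ==
  p.+1 then eps else 0))
   = fun i => 1 * (2^-1 * e i + 2^-1 * e' i) + (-1) * D i.
  by apply/funext => i; rewrite /D; lra.
have -> : (fun s => expR (U s)) = fun s => 1 * (2^-1 * expR (u s) + 2^-1 * expR (v s)) +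
  (-1) * f s.
  by apply/funext => s; rewrite -avg; lra.
rewrite polysol_lin// polysol_lin; try exact: even_cont_exp.
rewrite -uE -vE -/(U t) mul1r mulN1r.
rewrite gerBl.
have -> : D = fun i => 1 * (if i == k then del else 0) + (-1) * (if i == p.+1 then eps else 0).
  by apply/funext => i; rewrite /D; lra.
have -> : f = fun s => 1 * f s + (-1) * (fun=> 0) s.
  by apply/funext => s; rewrite mulr0 addr0 mul1r.
rewrite (polysol_lin _ _ _ _ _ ef (even_cont_const 0)) !polysol_delta//; last 2 first.
  exact: even_cont_const.
  by rewrite ltnS (leq_trans kp).
rewrite iter_invlap_zero addr0 mul1r mulN1r.
have eK := iter_invlap_even_cont d m ef.
rewrite -(even_cont_norm t eK) -(even_cont_norm t (monomial_even_cont d k))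
  -(even_cont_norm t (monomial_even_cont d p.+1)).
have := normr_ge0 t; move: `|t| => {}t t0.
rewrite !monomialE -/C1 -/C2.
have [rt|/ltW rt] := leP r1 t.
  have h1 : eps * C1 <= a.
    by rewrite -ler_pdivlMr// ge_min lexx.
  have := Ha t rt; have t2 : 0 <= t ^+ p.+1.*2 by rewrite exprn_ge0.
  have h2 := ler_wpM2r t2 h1.
  have h3 : 0 <= del * (C2 * t ^+ k.*2).
    by rewrite mulr_ge0 ?(ltW del0)// mulr_ge0 ?(ltW C20)// exprn_ge0.
  rewrite [eps * (C1 * _)]mulrA -/m; lra.
have h1 : eps * B <= del * C2.
  by rewrite -ler_pdivlMr// ge_min lexx orbT.
have kp2 : (k.*2 <= p.+1.*2)%N by rewrite leq_double (leq_trans kp).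
have h2 : eps * (C1 * t ^+ p.+1.*2) <= del * (C2 * t ^+ k.*2).
  rewrite -(subnK kp2) exprD !mulrA ler_wpM2r ?exprn_ge0//.
  apply: le_trans h1; rewrite /B mulrA; apply: ler_wpM2l.
    by apply: mulr_ge0; exact: ltW.
  by rewrite lerXn2r ?nnegrE// (ltW r10).
have := iter_invlap_ge0 d m ef f0 t; lra.
Qed.

End EntireData.

(** * Existence of global solutions in dimension at least 3 *)

Section Existence.
Context {R : realType} (d : nat).
Implicit Types (f g u v w : R -> R) (k p j m N : nat) (e : nat -> R) (a b c r s t x : R).

(** Minus this function has a positive Laplacian in dimension at least 3,
    although it is bounded; powers of (1 + t^2)^-1 with integer exponents fail
    in dimension 3. *)
Definition inv_bracket t : R := (Num.sqrt (1 + t ^+ 2))^-1.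

Lemma bracket_pos t : 0 < 1 + t ^+ 2 :> R.
Proof. by rewrite ltr_pwDl// sqr_ge0. Qed.

Lemma inv_bracket_gt0 t : 0 < inv_bracket t.
Proof. by rewrite invr_gt0 sqrtr_gt0 bracket_pos. Qed.

Lemma inv_bracket_sqr t : inv_bracket t ^+ 2 = (1 + t ^+ 2)^-1.
Proof. by rewrite /inv_bracket exprVn sqr_sqrtr// ltW// bracket_pos. Qed.

Lemma inv_bracket_le1 t : inv_bracket t <= 1.
Proof.
have h : inv_bracket t ^+ 2 <= 1 ^+ 2.
  by rewrite inv_bracket_sqr expr1n invf_le1 ?bracket_pos// lerDl sqr_ge0.
by rewrite -(@ler_pXn2r _ 2)// nnegrE// ltW// inv_bracket_gt0.
Qed.

Lemma is_derive_inv_bracket t : is_derive t (1:R) inv_bracket (- (t * inv_bracket t ^+ 3)).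
Proof.
have h1 : is_derive t (1:R) (fun t => 1 + t ^+ 2) (2 * t).
  by apply: is_derive_eq (is_derive_add (is_derive_const 1 t) (is_derive_pow 2 t)) _;
    rewrite add0r expr1.
have h2 := @is_derive1_comp R Num.sqrt (fun t => 1 + t ^+ 2) t _ _ (is_derive1_sqrt
  (bracket_pos t)) h1.
have s0 : Num.sqrt (1 + t ^+ 2) != 0 by rewrite gt_eqF// sqrtr_gt0 bracket_pos.
have h3 := is_derive_inv (f := Num.sqrt \o (fun t => 1 + t ^+ 2)) s0 h2.
apply: is_derive_eq h3 _; rewrite /inv_bracket /=; field.
by rewrite s0.
Qed.

Lemma inv_bracket_even_cont : even_cont inv_bracket.
Proof.
split; first by move=> t; rewrite /inv_bracket sqrrN.
by move=> t; exact: is_derive_continuous (is_derive_inv_bracket t).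
Qed.

(** The Laplacian of - (1 + t^2)^(-1/2) in dimension d + 1. *)
Definition bracket_source t : R := inv_bracket t ^+ 5 * (d.+1%:R + (d%:R - 2) * t ^+ 2).

Lemma even_contX f k : even_cont f -> even_cont (fun t => f t ^+ k).
Proof.
move=> ef; elim: k => [|k ih]; first exact: even_cont_const.
rewrite (_ : (fun t => _) = fun t => f t * f t ^+ k); first exact: even_contM.
by apply/funext => t; rewrite exprS.
Qed.

Lemma sqr_even_cont : even_cont (fun t : R => t ^+ 2).
Proof. by split=> [t|]; [rewrite sqrrN|exact: cont_pow]. Qed.

Lemma bracket_source_even_cont : even_cont bracket_source.
Proof.
apply: even_contM; first exact/even_contX/inv_bracket_even_cont.
apply: even_contD; first exact: even_cont_const.
apply: even_contZ; exact: sqr_even_cont.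
Qed.

Lemma invlap_bracket_source t : invlap d bracket_source t = 1 - inv_bracket t.
Proof.
have ej := bracket_source_even_cont.
have dX k x : is_derive x (1:R) (fun x => inv_bracket x ^+ k) (k%:R * inv_bracket x ^+
  k.-1 * - (x * inv_bracket x ^+ 3)).
  exact: (@is_derive1_comp R (fun x => x ^+ k) inv_bracket x _ _ (is_derive_pow k
    (inv_bracket x)) (is_derive_inv_bracket x)).
have wE : moment d bracket_source = fun x => x ^+ d.+1 * inv_bracket x ^+ 3.
  apply: primitive_unique; first exact: (moment_integrand_cont ej.2).
    by rewrite expr0n/= mul0r.
  move=> x; apply: is_derive_eq (is_derive_mul (is_derive_pow d.+1 x) (dX 3%N x)) _.
  have j0 : inv_bracket x != 0 by rewrite gt_eqF// inv_bracket_gt0.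
  have -> : inv_bracket x ^+ 3 = inv_bracket x ^+ 5 * (1 + x ^+ 2).
    rewrite -[5%N]/(3 + 2)%N exprD inv_bracket_sqr -mulrA mulVf ?mulr1//.
    by rewrite gt_eqF// bracket_pos.
  rewrite /bracket_source /= [x ^+ d.+1]exprS -(natr1 d).
  have e5 : inv_bracket x ^+ 2 * (1 + x ^+ 2) = 1.
    by rewrite inv_bracket_sqr mulVf// gt_eqF// bracket_pos.
  have -> : (3%:R * inv_bracket x ^+ 2 * - (x * (inv_bracket x ^+ 5 * (1 + x ^+ 2))))
      = - (3%:R * x * inv_bracket x ^+ 5) * (inv_bracket x ^+ 2 * (1 + x ^+ 2)) by ring.
  by rewrite e5; ring.
have mE x : x * mean d bracket_source x = x * inv_bracket x ^+ 3.
  have [->|x0] := eqVneq x 0; first by rewrite !mul0r.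
  by rewrite idmean_moment// wE exprS; field; rewrite expf_neq0.
have -> : invlap d bracket_source = fun x => 1 - inv_bracket x; last by [].
apply: primitive_unique.
- by apply: idmean_cont; exact: ej.2.
- by rewrite /inv_bracket expr0n addr0 sqrtr1 invr1 subrr.
- move=> x; apply: is_derive_eq (is_derive_sub (is_derive_const 1 x)
  (is_derive_inv_bracket x)) _.
  by rewrite mE sub0r opprK.
Qed.

Lemma bracket_source_ge t : (2 <= d)%N -> 3%:R * (1 + t ^+ 2)^-1 ^+ 3 <= bracket_source t.
Proof.
move=> d2; rewrite /bracket_source -inv_bracket_sqr -exprM -[(2 * 3)%N]/(5 + 1)%N exprD
  expr1 mulrC -mulrA.
apply: ler_wpM2l; first by rewrite exprn_ge0// ltW// inv_bracket_gt0.
have h1 : 3 <= d.+1%:R :> R by rewrite ler_nat.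
have h2 : 2 <= d%:R :> R by rewrite ler_nat.
have h3 : 0 <= (d%:R - 2) * t ^+ 2 :> R by rewrite mulr_ge0 ?sqr_ge0// subr_ge0.
have := inv_bracket_le1 t; lra.
Qed.

Lemma quad_bound b c x : 0 < c -> b * x <= c * x ^+ 2 + b ^+ 2 / (4 * c).
Proof.
move=> c0; rewrite -subr_ge0.
have -> : c * x ^+ 2 + b ^+ 2 / (4 * c) - b * x = (2 * c * x - b) ^+ 2 / (4 * c).
  by field; rewrite gt_eqF.
by rewrite divr_ge0 ?sqr_ge0// mulr_ge0// ltW.
Qed.

(** The level with the constant -1 dominates all lower-order data. *)
Lemma polysol_parabola p e : exists C a,
  0 < a /\ forall t, polysol d p.+1 e (fun=> -1) t <= C - a * t ^+ 2.
Proof.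
have K1 : invlap d (fun=> 1) = fun t : R => ((2 * (0 + d).+1)%:R)^-1 * t ^+ 2.
  by rewrite -invlap_pow; congr invlap; apply/funext => t.
set k1 : R := ((2 * (0 + d).+1)%:R)^-1 in K1.
have k10 : 0 < k1 by rewrite invr_gt0 ltr0n.
elim: p e => [|p ih] e.
  exists (e 0%N), k1; split=> // t /=.
  have -> : (fun _ : R => -1 : R) = (fun _ : R => -1 * 1) by apply/funext => x; rewrite mulr1.
  by rewrite invlap_scale; [rewrite K1 mulN1r|exact: cont_const].
have [C [a [a0 h]]] := ih (fun i => e i.+1).
pose k3 : R := ((4 * (2 + d).+1)%:R)^-1.
have k30 : 0 < k3 by rewrite invr_gt0 ltr0n.
pose b := C * k1 + 1; pose c := a * k3.
have c0 : 0 < c by rewrite mulr_gt0.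
exists (e 0%N + b ^+ 2 / (4 * c)), 1; split=> // t.
have eT := polysol_even_cont d p.+1 (fun i => e i.+1) (even_cont_const (-1 : R)).
have eP : even_cont (fun t => C * 1 + (- a) * t ^+ 2).
  by apply: even_cont_lin; [exact: even_cont_const|exact: sqr_even_cont].
have hK : invlap d (polysol d p.+1 (fun i => e i.+1) (fun=> -1)) t <= invlap d (fun t =>
  C * 1 + (- a) * t ^+ 2) t.
  by apply: invlap_le => // s; rewrite mulr1 mulNr; exact: h.
rewrite -[X in X <= _]/(e 0%N + invlap d (polysol d p.+1 (fun i => e i.+1) (fun=> -1)) t).
rewrite invlap_lin in hK; [|exact: cont_const|exact: cont_pow].
rewrite K1 invlap_pow -/k3 in hK.
have := quad_bound b (t ^+ 2) c0.
rewrite -exprM -[(2 * 2)%N]/4%N /b /c in hK *; lra.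
Qed.

Lemma expR_cube x : 0 <= x -> x ^+ 3 <= 6 * expR x.
Proof.
move=> x0; have := expR_ge1Dxn 2 x0; rewrite -[(3`!)%N]/6%N => h.
have : x ^+ 3 / 6 <= expR x by apply: le_trans h; rewrite lerDr.
by rewrite ler_pdivrMr// mulrC.
Qed.

(** Take w = -1 - M (1 + r^2)^(-1/2) as the level Delta^(p+1) U.  Then U is at
    most polysol d p.+1 e (-1) <= C - a r^2 whatever M >= 0 is, so that
    exp (U) <= M * bracket_source for M large, and K exp (U) is absorbed by the
    increase of w. *)
Lemma entire_data_nonempty p e : (2 <= d)%N -> exists c, entire_data d p.+2 (set_at e p.+1 c).
Proof.
move=> d2; have [C [a [a0 Hb]]] := polysol_parabola p e.
(* such that exp (C + a) * 6 / (a X)^3 = 3 M X^-3, see [expR_cube] *)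
pose M := expR (C + a) * 2 / a ^+ 3.
have M0 : 0 < M by rewrite divr_gt0 ?exprn_gt0// mulr_gt0// expR_gt0.
pose w t := - 1 - M * inv_bracket t.
have ew : even_cont w.
  rewrite (_ : w = fun t => (-1) * 1 + (- M) * inv_bracket t).
    by apply: even_cont_lin; [exact: even_cont_const|exact: inv_bracket_even_cont].
  by apply/funext => t; rewrite /w; ring.
pose U := polysol d p.+1 e w; have eU : even_cont U by exact: polysol_even_cont.
exists (- 1 - M); apply: (entire_data_of_supersolution _ eU) => // t.
rewrite polysol_snoc.
have -> : set_at e p.+1 (- 1 - M) p.+1 = - 1 - M by rewrite /set_at eqxx.
rewrite (polysol_eq_on d (e' := e)); last by move=> k kp; rewrite /set_at (ltn_eqF kp).
have eEU := even_cont_exp eU.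
apply: (polysol_le d) => //.
  by apply: even_contD; [exact: even_cont_const|exact: invlap_even_cont].
move=> s; rewrite /w.
have key : invlap d (fun t => expR (U t)) s <= M * (1 - inv_bracket s).
  rewrite -invlap_bracket_source -[M * _]/((fun t => M * invlap d bracket_source t) s)
    -invlap_scale; last exact: bracket_source_even_cont.2.
  apply: invlap_le => // [|x]; first exact/even_contZ/bracket_source_even_cont.
  have Ux : U x <= C - a * x ^+ 2.
    apply: le_trans (Hb x); apply: (polysol_le d) => //; first exact: even_cont_const.
    by move=> y; rewrite /w gerDl oppr_le0 mulr_ge0 ?(ltW M0)// ltW// inv_bracket_gt0.
  apply: (@le_trans _ _ (expR (C - a * x ^+ 2))); first by rewrite ler_expR.
  apply: (@le_trans _ _ (M * (3%:R * (1 + x ^+ 2)^-1 ^+ 3))); last first.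
    by rewrite ler_wpM2l ?bracket_source_ge// ltW.
  pose X := 1 + x ^+ 2; have X0 : 0 < X by exact: bracket_pos.
  have -> : C - a * x ^+ 2 = (C + a) + - (a * X) by rewrite /X; ring.
  rewrite expRD expRN -/X.
  have aX : 0 <= a * X by rewrite mulr_ge0// ltW.
  have h := expR_cube aX.
  have -> : M * (3%:R * X^-1 ^+ 3) = expR (C + a) * (6 / (a * X) ^+ 3).
    by rewrite /M; field; rewrite !gt_eqF.
  apply: ler_wpM2l; first exact: expR_ge0.
  rewrite ler_pdivlMr; last by rewrite exprn_gt0// mulr_gt0.
  by rewrite mulrC ler_pdivrMr// expR_gt0.
lra.
Qed.

End Existence.

(** * The threshold function *)

Section Hypograph.
Context {R : realType} (p : nat) (A : 'rV[R]_p -> R -> Prop).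
Implicit Types (b : 'rV[R]_p) (s t c : R).

Context (A_ex : forall b, exists t, A b t).
Context (A_lt0 : forall b t, A b t -> t < 0).
Context (A_le : forall b b' t t', (forall i, b' 0 i <= b 0 i) -> t' <= t ->
  A b t -> A b' t').
Context (A_closed : forall b t, (forall eps, 0 < eps -> A b (t - eps)) -> A b t).
Context (A_convex : forall b b' t t' a c, 0 <= a -> 0 <= c -> a + c = 1 ->
  A b t -> A b' t' -> A (a *: b + c *: b') (a * t + c * t')).
Context (A_strict : forall b (k : 'I_p) s v t, s < v -> A (set_entry b k v) t ->
  exists2 eps, 0 < eps & A (set_entry b k s) (t + eps)).

(** The hypotheses make A the region below the graph of this function. *)
Definition threshold b : R := sup [set t | A b t].

Lemma thresholdP b t : A b t <-> t <= threshold b.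
Proof.
have hs : has_sup [set t | A b t].
  by split; [exact: A_ex|exists 0 => s /A_lt0/ltW].
split; first by move=> h; exact: ub_le_sup hs.2 _ h.
move=> tt; apply: A_closed => eps eps0.
have [s As] := sup_adherent eps0 hs; rewrite -/(threshold b) => h.
by apply: A_le As => //; lra.
Qed.

Lemma threshold_attained b : A b (threshold b).
Proof. exact/thresholdP. Qed.

Lemma threshold_lt0 b : threshold b < 0.
Proof. exact: A_lt0 (threshold_attained b). Qed.

Lemma threshold_antimono b b' : (forall i, b' 0 i <= b 0 i) -> threshold b <= threshold b'.
Proof. by move=> bb; apply/thresholdP; apply: A_le (threshold_attained b). Qed.

Lemma threshold_concave b b' a c : 0 <= a -> 0 <= c -> a + c = 1 ->
  a * threshold b + c * threshold b' <= threshold (a *: b + c *: b').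
Proof. by move=> a0 c0 ac; apply/thresholdP; apply: A_convex => //;
  exact: threshold_attained. Qed.

(** For a concave nonincreasing function: b' lies between b - del and b + del.
    The value at b + del is bounded below by interpolation between b and b + 1,
    the value at b - del is bounded above by writing b as a convex combination of
    b - del and b + 1. *)
Lemma threshold_near b b' del : 0 < del <= 1 -> (forall i, `|b 0 i - b' 0 i| <= del) ->
  `|threshold b - threshold b'| <= del * (threshold b - threshold (b + const_mx 1)).
Proof.
move=> /andP[del0 del1] bb; set b1 := b + const_mx 1.
have h1 : (1 - del) * threshold b + del * threshold b1 <= threshold b'.
  apply: le_trans (threshold_concave _ _ _ _ _) _; [lra|lra|lra|].
  apply: threshold_antimono => i; rewrite !mxE; have := bb i; rewrite ler_norml.
  by move: (b 0 i) (b' 0 i) => x y; lra.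
have d1 : 0 < 1 + del by lra.
have h2 : (1 + del)^-1 * threshold b' + (1 + del)^-1 * del * threshold b1 <= threshold b.
  apply: le_trans (threshold_concave _ _ _ _ _) _.
  - by rewrite invr_ge0 ltW.
  - by apply: mulr_ge0; [rewrite invr_ge0|]; exact: ltW.
  - by rewrite -{1}[(1 + del)^-1]mulr1 -mulrDr mulVf// gt_eqF.
  - apply: threshold_antimono => i; rewrite !mxE; have := bb i; rewrite ler_norml.
    move: (b 0 i) (b' 0 i) => x y h.
    rewrite -mulrA -mulrDr -[X in X <= _](mulKf (lt0r_neq0 d1)) ler_wpM2l ?invr_ge0 ?(ltW
      d1)//.
    lra.
have h3 : threshold b' + del * threshold b1 <= (1 + del) * threshold b.
  by rewrite -ler_pdivrMl// mulrDr mulrA.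
by rewrite ler_norml; lra.
Qed.

Lemma threshold_continuous : continuous threshold.
Proof.
move=> b; apply/(@cvgrPdist_le _ _ _ (nbhs b) (nbhs_filter b)) => eps eps0.
set g := threshold b - threshold (b + const_mx 1).
have g0 : 0 <= g.
  by rewrite subr_ge0; apply: threshold_antimono => i; rewrite !mxE lerDl.
pose del := Num.min 1 (eps / (g + 1)).
have g1 : 0 < g + 1 by lra.
have del0 : 0 < del by rewrite lt_min ltr01 divr_gt0.
apply/nbhs_ballP; exists del => //= b' [_ bb].
apply: (@le_trans _ _ (del * g)).
  apply: threshold_near; first by rewrite del0 ge_min lexx.
  by move=> i; have := bb 0 i => /ltW.
have : del * (g + 1) <= eps by rewrite -ler_pdivlMr// ge_min lexx orbT.
by apply: le_trans; rewrite ler_pM2l// lerDl.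
Qed.

Lemma threshold_decreasing b (k : 'I_p) s t : s < t ->
  threshold (set_entry b k t) < threshold (set_entry b k s).
Proof.
move=> st; have [eps eps0 /thresholdP] := A_strict st (threshold_attained (set_entry b k t)).
by apply: lt_le_trans; rewrite ltrDl.
Qed.

Let S := [set beta : 'rV[R]_p.+1 | last_entry beta <= threshold (init_entries beta)].
Let S' := [set beta : 'rV[R]_p.+1 | last_entry beta < threshold (init_entries beta)].

Lemma init_continuous : continuous (@init_entries R p).
Proof.
move=> be U /= /(nbhs_ballP (init_entries be)) [eps eps0 epsU].
apply/nbhs_ballP; exists eps => //= be' [_ h].
by apply: epsU; split=> // i j; rewrite !mxE; exact: h.
Qed.

Lemma threshold_gap_continuous : continuous (fun beta : 'rV[R]_p.+1 => threshold
  (init_entries beta) - last_entry beta).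
Proof.
move=> be.
apply: (@cvgB _ _ _ (nbhs be) (nbhs_filter be)
  (fun x : 'rV[R]_p.+1 => threshold (init_entries x)) (fun x : 'rV[R]_p.+1 => last_entry x)).
  exact: (@continuous_cvg _ _ _ (nbhs be) (nbhs_filter be) (@init_entries R p) threshold _
    (@threshold_continuous _) (@init_continuous be)).
exact: (@coord_continuous R 1 p.+1 0 ord_max be).
Qed.

Lemma hypo_closed : closed S.
Proof.
rewrite (_ : S = (fun beta : 'rV[R]_p.+1 => threshold (init_entries beta) - last_entry
  beta) @^-1` [set x | 0 <= x]).
  by apply: closed_comp; [move=> x _; exact: threshold_gap_continuous|exact: closed_ge].
by apply/seteqP; split => x; rewrite /S /= subr_ge0.
Qed.

Lemma hypo_open : open S'.
Proof.
rewrite (_ : S' = (fun beta : 'rV[R]_p.+1 => threshold (init_entries beta) - last_entry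
  beta) @^-1` [set x | 0 < x]).
  by apply: open_comp; [move=> x _; exact: threshold_gap_continuous|exact: open_gt].
by apply/seteqP; split => x; rewrite /S' /= subr_gt0.
Qed.

(** A point of the graph is not interior: raising its last entry leaves the
    set. *)
Lemma hypo_interior : interior S = S'.
Proof.
apply/seteqP; split; last first.
  by rewrite -open_subsetE; [move=> x /ltW|exact: hypo_open].
move=> be Sbe; have /= := interior_subset Sbe; rewrite /S /S' /= le_eqVlt => /predU1P[e|//].
move: Sbe => /nbhs_ballP[eps /= eps0 Hball].
pose be' := be + (eps / 2) *: delta_mx 0 ord_max.
have hi : init_entries be' = init_entries be.
  apply/rowP => j; rewrite !mxE /=.
  by rewrite (_ : lift ord_max j == ord_max = false) ?mulr0 ?addr0// eq_sym;
    exact/negbTE/neq_lift.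
have hl : last_entry be' = last_entry be + eps / 2.
  by rewrite /last_entry !mxE !eqxx mulr1.
have : S be'.
  apply: Hball; split=> // i j; rewrite /ball /= !mxE opprD addrA subrr sub0r normrN.
  rewrite normrM (ger0_norm (ltW (divr_gt0 eps0 _)))//.
  apply: (@le_lt_trans _ _ (eps / 2)); last by lra.
  by rewrite normr_nat; case: (_ && _); rewrite ?mulr1 ?mulr0//; lra.
by rewrite /S /= hi hl e; lra.
Qed.

Lemma hypo_boundary : boundary S = [set beta | last_entry beta = threshold (init_entries
  beta)].
Proof.
rewrite /boundary -(closure_id S).1; last exact: hypo_closed.
rewrite hypo_interior; apply/seteqP; split => be; rewrite /S /S' /=.
  by move=> [h /negP]; rewrite -leNgt => h'; apply/eqP; rewrite eq_le h h'.
by move=> ->; rewrite lexx ltxx.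
Qed.

End Hypograph.

Section DataSet.
Context {R : realType} (d p : nat) (alpha : R).
Implicit Types (b : 'rV[R]_p) (s t c : R).

Definition admissible b t := entire_data d p.+2 (set_at (data_seq alpha b) p.+1 t).

Lemma entire_data_eq_on m (e e' : nat -> R) : (forall k, (k < m)%N -> e k = e' k) ->
  entire_data d m e -> entire_data d m e'.
Proof. by move=> ee [u [eu uE]]; exists u; split=> //; rewrite -(polysol_eq_on _ _ ee). Qed.

Lemma data_seq_split (beta : 'rV[R]_p.+1) k : (k < p.+2)%N ->
  data_seq alpha beta k = set_at (data_seq alpha (init_entries beta)) p.+1 (last_entry beta) k.
Proof.
rewrite /set_at; case: k => // k; rewrite !ltnS eqSS leq_eqVlt => kp.
have [e|kp'] := eqVneq k p.
  by have := data_seqS alpha beta ord_max; rewrite {1}e.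
have {kp} kp'' : (k < p)%N by move: kp; rewrite (negbTE kp').
rewrite (data_seqS alpha (init_entries beta) (Ordinal kp'')) mxE.
have := data_seqS alpha beta (lift ord_max (Ordinal kp'')).
by rewrite lift_max.
Qed.

Lemma admissible_lt0 b t : admissible b t -> t < 0.
Proof. by move=> /entire_data_last_lt0; rewrite /set_at eqxx. Qed.

Lemma admissible_le b b' t t' : (forall i, b' 0 i <= b 0 i) -> t' <= t ->
  admissible b t -> admissible b' t'.
Proof.
move=> bb tt; apply: entire_data_le => // k kp; rewrite /set_at; case: eqP => // kp'.
case: k kp kp' => // k kp kp'; have kp2 : (k < p)%N.
  by move: kp kp'; rewrite !ltnS leq_eqVlt => /predU1P[->|].
by rewrite (data_seqS _ b (Ordinal kp2)) (data_seqS _ b' (Ordinal kp2)).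
Qed.

Lemma admissible_closed b t : (forall eps, 0 < eps -> admissible b (t - eps)) ->
  admissible b t.
Proof.
move=> H; apply: entire_data_closed => eps eps0; apply: entire_data_eq_on (H eps eps0) => k _.
by rewrite /set_at eqxx; case: eqP.
Qed.

Lemma admissible_convex b b' t t' a c : 0 <= a -> 0 <= c -> a + c = 1 ->
  admissible b t -> admissible b' t' -> admissible (a *: b + c *: b') (a * t + c * t').
Proof.
move=> a0 c0 ac h h'; apply: entire_data_eq_on (entire_data_convex _ a0 c0 ac h h') => // k kp.
rewrite /set_at; case: eqP => // kp'.
case: k kp kp' => [|k] kp kp'; first by rewrite -mulrDl ac mul1r.
have kp2 : (k < p)%N by move: kp kp'; rewrite !ltnS leq_eqVlt => /predU1P[->|].
by rewrite (data_seqS _ b (Ordinal kp2)) (data_seqS _ b' (Ordinal kp2)) (data_seqS _ _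
  (Ordinal kp2)) !mxE.
Qed.

(** Halfway between the data with entries s and v at k, and lowered by
    (v - s)/2 there, the entry at k is s again. *)
Lemma admissible_strict b (k : 'I_p) s v t : s < v -> admissible (set_entry b k v) t ->
  exists2 eps, 0 < eps & admissible (set_entry b k s) (t + eps).
Proof.
move=> sv h.
have h' : admissible (set_entry b k s) t.
  apply: admissible_le h => // i; rewrite !mxE; case: eqP => // _; exact: ltW.
have kp := ltn_ord k.
have del0 : 0 < (v - s) / 2 by lra.
have kb : (0 < k.+1 <= p)%N by [].
have kp2 : (k.+1 < p.+2)%N by rewrite !ltnS ltnW.
have [|eps eps0 E] := entire_data_strict kb kp2 _ del0 h h'.
  rewrite /set_at eqSS (ltn_eqF kp) !data_seqS !mxE eqxx.
  by rewrite gt_eqF.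
exists eps; first exact: eps0.
apply: entire_data_eq_on E => -[|i] ip.
  by rewrite /set_at /=; lra.
rewrite /set_at !eqSS; have [->|ip'] := eqVneq i p.
  by rewrite (gtn_eqF kp); lra.
have ip2 : (i < p)%N by move: ip; rewrite !ltnS leq_eqVlt (negbTE ip').
rewrite (data_seqS _ _ (Ordinal ip2)) (data_seqS _ (set_entry b k s) (Ordinal ip2)) !mxE.
rewrite -val_eqE /=; case: eqP => _; lra.
Qed.

Lemma admissible_ex b : (2 <= d)%N -> exists t, admissible b t.
Proof. exact: entire_data_nonempty. Qed.

Lemma global_admissible (beta : 'rV[R]_(p.+2.-2.+1)) : ~~ odd p.+2 ->
  global_data p.+2 d.+1 alpha beta <-> admissible (init_entries beta) (last_entry beta).
Proof.
move=> ev; apply: (iff_trans (global_dataP d alpha beta ev)).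
split; apply: entire_data_eq_on => k kp; rewrite data_seq_split//.
Qed.

End DataSet.

Theorem theorem2p2 (R : realType) (m n : nat) (m_ge2 : (2 <= m)%N)
    (m_even : ~~ odd m) (n_ge1 : (1 <= n)%N) :
  ((n = 1%N \/ n = 2%N) ->
     forall alpha : R, global_data m n alpha = set0) /\
  ((3 <= n)%N ->
     forall alpha : R,
       global_data m n alpha !=set0 /\
       exists Phi : 'rV[R]_(m.-2) -> R,
         [/\ (forall b, Phi b < 0) /\
             global_data m n alpha =
               [set beta : 'rV[R]_(m.-2.+1) |
                  last_entry beta <= Phi (init_entries beta)],
             continuous Phi,
             closed (global_data m n alpha),
             boundary (global_data m n alpha) =
               [set beta : 'rV[R]_(m.-2.+1) |
                  last_entry beta = Phi (init_entries beta)] /\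
             interior (global_data m n alpha) =
               [set beta : 'rV[R]_(m.-2.+1) |
                  last_entry beta < Phi (init_entries beta)] &
             (4 <= m)%N ->
               forall (k : 'I_(m.-2)) (b : 'rV[R]_(m.-2)) (s t : R),
                 s < t -> Phi (set_entry b k t) < Phi (set_entry b k s)]).
Proof.
case: m m_ge2 m_even => [|[|p]]// _ ev; case: n n_ge1 => // d _; split.
  move=> d1 alpha; rewrite -subset0 => beta /(global_admissible d alpha beta ev).
  by apply: entire_low_dim; case: d1 => -[->].
move=> d2 alpha.
have A1 b := @admissible_ex R d p alpha b d2.
have A2 := @admissible_lt0 R d p alpha.
have A3 := @admissible_le R d p alpha.
have A4 := @admissible_closed R d p alpha.
have A5 := @admissible_convex R d p alpha.
have A6 := @admissible_strict R d p alpha.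
pose Phi := threshold (admissible d alpha (p := p)).
have GE : global_data p.+2 d.+1 alpha =
    [set beta : 'rV[R]_p.+1 | last_entry beta <= Phi (init_entries beta)].
  apply/seteqP; split => beta.
    by move=> /(global_admissible d alpha beta ev)/(thresholdP A1 A2 A3 A4).
  by move=> /(thresholdP A1 A2 A3 A4)/(global_admissible d alpha beta ev).
split.
  rewrite GE.
  exists (\row_(i < p.+1) if unlift ord_max i is Some _ then 0 else Phi 0).
  rewrite /= /last_entry mxE unlift_none.
  suff -> : init_entries (\row_(i < p.+1) if unlift ord_max i is Some _ then 0 else Phi 0) = 0 by [].
  by apply/rowP => j; rewrite !mxE liftK.
exists Phi; rewrite GE; split.
- by split=> // b; exact: threshold_lt0.
- exact: threshold_continuous.
- exact: hypo_closed.
- by split; [exact: hypo_boundary|exact: hypo_interior].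
- by move=> _ k b s t; exact: threshold_decreasing.
Qed.
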